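(* Let $H$ be a complex Hilbert space, let $f\in C^2((0,\infty))\cap\mathcal{D}^{(1)}$ be a real function on $(0,\infty)$, and let $0\leq\nu\leq1$. For positive definite operators $A,B\in B(H)$ put $$X:=\nu f(A)+(1-\nu)f(B)-\int_0^1f((1-t)A+tB)\,dt.$$ (i) If $\|f'(\cdot)\|$ is quasi-convex on $\sigma((0,\infty))$, then for all positive definite operators $A,B$ $$\|X\|\leq\left(\nu^2-\nu+\tfrac{1}{2}\right)\|B-A\|\max\{\|f'(A)\|,\|f'(B)\|\}.$$ (ii) If $s\in(0,1]$ and $\|f'(\cdot)\|$ is $s$-convex on $\sigma((0,\infty))$, then for all positive definite operators $A,B$ $$\begin{aligned} \|X\|\leq\ &\left(\frac{1}{s+2}-\frac{1-\nu}{s+1}+\frac{2(1-\nu)^{s+2}}{(s+1)(s+2)}\right)\|f'(A)\|\,\|B-A\|\\ &+\left(\frac{1}{s+2}-\frac{\nu}{s+1}+\frac{2\nu^{s+2}}{(s+1)(s+2)}\right)\|f'(B)\|\,\|B-A\|. \end{aligned}$$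
   Context: $B(H)$ is the algebra of bounded linear operators on $H$, $\|\cdot\|$ is the operator norm, and $Sp(A)$ is the spectrum of $A$. For an interval $I$, $\sigma(I)$ is the set of self-adjoint $A\in B(H)$ with $Sp(A)\subseteq I$. A positive definite operator means a bounded self-adjoint operator $A$ with $\langle Ax,x\rangle>0$ for all $x\ne 0$ and $Sp(A)\subseteq(0,\infty)$. For continuous real $g$ on $I$ and $A\in\sigma(I)$, $g(A)$ is given by the continuous functional calculus, and $\|g(\cdot)\|$ denotes the map $\sigma(I)\to[0,\infty)$, $A\mapsto\|g(A)\|$. For a map $\Phi:\sigma((0,\infty))\to[0,\infty)$: $\Phi$ is quasi-convex if $\Phi((1-t)A+tB)\le\max\{\Phi(A),\Phi(B)\}$, and $s$-convex (for fixed $s\in(0,1]$) if $\Phi((1-t)A+tB)\le(1-t)^s\Phi(A)+t^s\Phi(B)$, for all $A,B\in\sigma((0,\infty))$ and $t\in[0,1]$. $Df(A)$ is the Fréchet derivative at $A$ of the map $X\mapsto f(X)$, a linear operator on the space of bounded self-adjoint operators, with norm $\|Df(A)\|=\sup\{\|Df(A)(B)\|:\|B\|=1\}$ ($B$ self-adjoint). $\mathcal{D}^{(1)}$ is the set of functions $f$ on $(0,\infty)$ with $\|Df(A)\|=\|f'(A)\|$ for all positive definite operators $A$. *)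

(* Defs.v *)
From HB Require Import structures.
From mathcomp Require Import all_boot all_order all_algebra.
From mathcomp Require Import complex.
From mathcomp Require Import all_classical all_reals all_analysis.

Set Implicit Arguments.
Unset Strict Implicit.
Unset Printing Implicit Defensive.

Import Order.TTheory GRing.Theory Num.Theory.
Import numFieldNormedType.Exports.

Local Open Scope ring_scope.
Local Open Scope complex_scope.
Local Open Scope classical_set_scope.

(** The inner product is linear in its first argument; the norm of a normed
    module over [R[i]] takes its (nonnegative real) values in [R[i]]. *)
HB.mixin Record CompleteNormedModule_isHilbert (R : realType) H
    & CompleteNormedModule R[i] H := {
  inner : {dot H for @Num.conj R[i]};
  inner_norm : forall x : H, inner x x = `|x| ^+ 2;
}.

#[short(type="hilbertType")]
HB.structure Definition Hilbert (R : realType) :=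
  {H of CompleteNormedModule R[i] H & CompleteNormedModule_isHilbert R H}.

Section BoundedOperators.
Context {R : realType} (H : hilbertType R).

Definition bounded_operator : {pred H -> H} := fun f =>
  `[< linear f /\ exists M : R, forall x, `|f x| <= M%:C * `|x| >].

Record bop := Bop { bop_fun :> H -> H; _ : bop_fun \in bounded_operator }.

HB.instance Definition _ := [isSub for bop_fun].
HB.instance Definition _ := [Choice of bop by <:].

Lemma boundedP (f : H -> H) : reflect
  (linear f /\ exists2 M : R, 0 <= M & forall x, `|f x| <= M%:C * `|x|)
  (f \in bounded_operator).
Proof.
apply: (iffP idP) => [/asboolP[lf [M fM]]|[lf [M _ fM]]]; last first.
  by apply/asboolP; split=> //; exists M.
split=> //; exists `|M| => // x; apply: le_trans (fM x) _.
by rewrite ler_wpM2r// lecR ler_norm.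
Qed.

Lemma bounded_submod_closed : GRing.submod_closed bounded_operator.
Proof.
split.
  apply/boundedP; split=> [a x y|]; first by rewrite scaler0 addr0.
  by exists 0 => // x; rewrite normr0 mul0r.
move=> a f g /boundedP[lf [M M0 fM]] /boundedP[lg [N N0 gN]].
apply/boundedP; split=> [b x y|].
  rewrite !addrfctE !scalrfctE lf lg !scalerDr !scalerA (mulrC a b) -!addrA.
  by congr (_ + _); rewrite addrCA.
exists (complex.Re `|a| * M + N) => [|x].
  rewrite addr_ge0// mulr_ge0//.
  by have := normr_ge0 a; rewrite lecE => /andP[].
have aE : (complex.Re `|a|)%:C = `|a| by rewrite RRe_real.
have -> : (complex.Re `|a| * M + N)%:C = `|a| * M%:C + N%:C.
  by rewrite rmorphD rmorphM/= aE.
rewrite addrfctE scalrfctE (le_trans (ler_normD _ _))// mulrDl lerD//.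
by rewrite normrZ -mulrA ler_wpM2l.
Qed.

HB.instance Definition _ :=
  GRing.isSubmodClosed.Build R[i] (H -> H) bounded_operator
    bounded_submod_closed.
HB.instance Definition _ := [SubChoice_isSubLmodule of bop by <:].

Lemma bop_linear (A : bop) : linear A.
Proof. by have /boundedP[] := valP A. Qed.

Lemma bopP (A B : bop) : A =1 B -> A = B.
Proof. by move=> AB; apply/val_inj/funext. Qed.

Lemma bopDE (A B : bop) x : (A + B) x = A x + B x. Proof. by []. Qed.
Lemma bopZE (a : R[i]) (A : bop) x : (a *: A) x = a *: A x. Proof. by []. Qed.

Lemma bop1_subproof : (idfun : H -> H) \in bounded_operator.
Proof.
by apply/boundedP; split=> //; exists 1 => // x; rewrite mul1r.
Qed.
Definition bop1 := Bop bop1_subproof.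

Lemma bopM_subproof (A B : bop) : A \o B \in bounded_operator.
Proof.
have /boundedP[lA [M M0 AM]] := valP A; have /boundedP[lB [N N0 BN]] := valP B.
apply/boundedP; split=> [a x y|] /=; first by rewrite lB lA.
exists (M * N) => [|x]; first exact: mulr_ge0.
rewrite (le_trans (AM _))// rmorphM/= -mulrA ler_wpM2l//.
by rewrite lecR.
Qed.
Definition bopM (A B : bop) := Bop (bopM_subproof A B).

Lemma bopMA : associative bopM. Proof. by move=> A B C; exact: bopP. Qed.
Lemma bop1M : left_id bop1 bopM. Proof. by move=> A; exact: bopP. Qed.
Lemma bopM1 : right_id bop1 bopM. Proof. by move=> A; exact: bopP. Qed.
Lemma bopMDl : left_distributive bopM +%R.
Proof. by move=> A B C; exact: bopP. Qed.
Lemma bopMDr : right_distributive bopM +%R.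
Proof.
move=> A B C; apply: bopP => x; rewrite bopDE /=.
by have := bop_linear A 1 (B x) (C x); rewrite !scale1r.
Qed.

(* Only a [pzRingType]: when [H] is the zero space, [0 = 1] in B(H). *)
HB.instance Definition _ :=
  GRing.Zmodule_isPzRing.Build bop bopMA bop1M bopM1 bopMDl bopMDr.

Definition opnorm (A : bop) : R :=
  sup [set complex.Re `|A x| | x in [set x : H | `|x| <= 1]].

Definition spectrum (A : bop) : set R[i] :=
  [set l : R[i] | ~ exists B : bop,
    B * (A - l *: (1 : bop)) = 1 /\ (A - l *: (1 : bop)) * B = 1].

Let hnorm_ge0 (x : H) : 0 <= complex.Re `|x|.
Proof. by have := normr_ge0 x; rewrite lecE => /andP[]. Qed.

Let hnormE (x : H) : (complex.Re `|x|)%:C = `|x|.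
Proof. by rewrite RRe_real. Qed.

Lemma opnorm_has_sup (A : bop) :
  has_sup [set complex.Re `|A x| | x in [set x : H | `|x| <= 1]].
Proof.
split; first by exists (complex.Re `|A 0|), 0 => //=; rewrite normr0.
have /boundedP[_ [M M0 AM]] := valP A.
exists M => _ [x /= x1 <-]; rewrite -lecR hnormE (le_trans (AM x))//.
by rewrite ler_piMr// lecR.
Qed.

Lemma opnorm_ge0 (A : bop) : 0 <= opnorm A.
Proof.
apply: (le_trans (hnorm_ge0 (A 0))).
apply: ub_le_sup; first exact: (opnorm_has_sup A).2.
by exists 0 => //=; rewrite normr0.
Qed.

Lemma le_opnorm (A : bop) x : `|A x| <= (opnorm A)%:C * `|x|.
Proof.
have A0 : A 0 = 0.
  by have := bop_linear A (-1) 0 0; rewrite scaler0 addr0 scaleN1r addNr.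
have [->|x0] := eqVneq x 0; first by rewrite A0 !normr0 mulr0.
have ax : `| `|x|^-1 | = `|x|^-1 by rewrite normfV normr_id.
have y1 : `| `|x|^-1 *: x | <= 1 by rewrite normrZ ax mulVf ?normr_eq0.
have : `|A (`|x|^-1 *: x)| <= (opnorm A)%:C.
  rewrite -hnormE lecR; apply: ub_le_sup; first exact: (opnorm_has_sup A).2.
  by exists (`|x|^-1 *: x).
have -> : A (`|x|^-1 *: x) = `|x|^-1 *: A x.
  by have := bop_linear A `|x|^-1 x 0; rewrite A0 !addr0.
by rewrite normrZ ax ler_pdivrMl ?normr_gt0// mulrC.
Qed.

Lemma opnorm_le (A : bop) (M : R) :
  0 <= M -> (forall x, `|A x| <= M%:C * `|x|) -> opnorm A <= M.
Proof.
move=> M0 AM; apply: ge_sup; first exact: (opnorm_has_sup A).1.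
move=> _ [x /= x1 <-]; rewrite -lecR hnormE (le_trans (AM x))//.
by rewrite ler_piMr// lecR.
Qed.

Lemma opnormD (A B : bop) : opnorm (A + B) <= opnorm A + opnorm B.
Proof.
apply: opnorm_le => [|x]; first by rewrite addr_ge0 ?opnorm_ge0.
rewrite bopDE (le_trans (ler_normD _ _))// rmorphD mulrDl.
by rewrite lerD ?le_opnorm.
Qed.

Lemma opnorm_eq0 (A : bop) : opnorm A = 0 -> A = 0.
Proof.
move=> A0; apply: bopP => x; apply/eqP; rewrite -normr_le0.
by have := le_opnorm A x; rewrite A0 mul0r.
Qed.

Lemma opnormZ (r : R) (A : bop) : opnorm (r%:C *: A) = `|r| * opnorm A.
Proof.
have le s (B : bop) : opnorm (s%:C *: B) <= `|s| * opnorm B.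
  apply: opnorm_le => [|x]; first by rewrite mulr_ge0 ?opnorm_ge0.
  rewrite bopZE normrZ normc_def/= expr0n/= addr0 sqrtr_sqr rmorphM/=.
  by rewrite -mulrA ler_wpM2l ?le_opnorm// lecR.
apply/eqP; rewrite eq_le le/=.
have [->|r0] := eqVneq r 0; first by rewrite normr0 mul0r opnorm_ge0.
have := le r^-1 (r%:C *: A).
rewrite scalerA -rmorphM/= mulVf// scale1r normfV => h.
by rewrite -ler_pdivlMl ?normr_gt0.
Qed.

Definition selfadjoint : {pred bop} := fun A =>
  `[< forall x y, inner (A x) y = inner x (A y) >].

Record sa := Sa { sa_op :> bop; _ : sa_op \in selfadjoint }.

HB.instance Definition _ := [isSub for sa_op].
HB.instance Definition _ := [Choice of sa by <:].

Lemma selfadjointP (A : bop) :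
  reflect (forall x y, inner (A x) y = inner x (A y)) (A \in selfadjoint).
Proof. exact: asboolP. Qed.

Lemma selfadjoint_zmod_closed : zmod_closed selfadjoint.
Proof.
split=> [|A B /selfadjointP sA /selfadjointP sB]; apply/selfadjointP => x y.
  by rewrite linear0l linear0r.
have bopBE z : (A - B) z = A z - B z by [].
by rewrite !bopBE linearBl linearBr/= sA sB.
Qed.

HB.instance Definition _ :=
  GRing.isZmodClosed.Build bop selfadjoint selfadjoint_zmod_closed.
HB.instance Definition _ := [SubChoice_isSubZmodule of sa by <:].

Lemma saZ_subproof (r : R) (A : sa) : r%:C *: (A : bop) \in selfadjoint.
Proof.
have /selfadjointP sA := valP A; apply/selfadjointP => x y.
rewrite !bopZE linearZl_LR linearZr_LR/= sA; congr (_ * _).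
by apply/esym/CrealP; rewrite complex_real.
Qed.
Definition saZ (r : R) (A : sa) : sa := Sa (saZ_subproof r A).

Lemma saZA r s (A : sa) : saZ r (saZ s A) = saZ (r * s) A.
Proof. by apply: val_inj; rewrite /= scalerA rmorphM. Qed.
Lemma sa1Z : left_id 1 saZ.
Proof. by move=> A; apply: val_inj; rewrite /= scale1r. Qed.
Lemma saZDr : right_distributive saZ +%R.
Proof. by move=> r A B; apply: val_inj; rewrite /= scalerDr. Qed.
Lemma saZDl A : {morph saZ^~ A : r s / r + s}.
Proof. by move=> r s; apply: val_inj; rewrite /= rmorphD scalerDl. Qed.

HB.instance Definition _ :=
  GRing.Zmodule_isLmodule.Build R sa saZA sa1Z saZDr saZDl.

Lemma sa_normD (A B : sa) : opnorm (A + B) <= opnorm A + opnorm B.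
Proof. exact: opnormD. Qed.
Lemma sa_normZ (r : R) (A : sa) : opnorm (r *: A) = `|r| * opnorm A.
Proof. exact: opnormZ. Qed.
Lemma sa_norm_eq0 (A : sa) : opnorm A = 0 -> A = 0.
Proof. by move=> /opnorm_eq0 A0; apply: val_inj. Qed.

HB.instance Definition _ :=
  Lmodule_isNormed.Build R sa sa_normD sa_normZ sa_norm_eq0.

End BoundedOperators.

Section FunctionalCalculus.
Context {R : realType} {H : hilbertType R}.
Implicit Types (A B : sa H) (I : set R).

(** Self-adjoint operators whose spectrum consists of (real) points of the interval [I]. *)
Definition sigma I : set (sa H) :=
  [set A | spectrum A `<=` [set r%:C | r in I]].

Definition posdef A : Prop :=
  (forall x : H, x != 0 -> 0 < inner (A x) x) /\ sigma `]0, +oo[ A.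

Definition poly_op (p : {poly R}) (A : bop H) : bop H :=
  \sum_(i < size p) (p`_i)%:C *: A ^+ i.

(** [T] is the norm limit of [p_n(A)] for some real polynomials [p_n] that
    converge to [g] uniformly on the spectrum of [A]. *)
Definition is_cfc (g : R -> R) A (T : sa H) : Prop :=
  exists p : nat -> {poly R},
    (forall e : R, 0 < e -> \forall n \near \oo,
       forall r : R, spectrum A r%:C -> `|(p n).[r] - g r| < e) /\
    (fun n => opnorm (poly_op (p n) A - (T : bop H))) @ \oo --> (0 : R).

(** [g(A)]; meaningful only when [g] is continuous on the spectrum of [A], in
    which case exactly one [T] satisfies [is_cfc g A T]. *)
Definition cfc (g : R -> R) A : sa H := get (is_cfc g A).

Definition quasi_convex_on (D : set (sa H)) (Phi : sa H -> R) : Prop :=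
  forall A B (t : R), D A -> D B -> 0 <= t <= 1 ->
    Phi ((1 - t) *: A + t *: B) <= Num.max (Phi A) (Phi B).

Definition s_convex_on (s : R) (D : set (sa H)) (Phi : sa H -> R) : Prop :=
  forall A B (t : R), D A -> D B -> 0 <= t <= 1 ->
    Phi ((1 - t) *: A + t *: B) <= (1 - t) `^ s * Phi A + t `^ s * Phi B.

(** The supremum over an empty unit sphere ([H] the zero space) is [0]. *)
Definition superopnorm (L : sa H -> sa H) : R :=
  sup [set `|L B| | B in [set B | `|B| = 1]].

End FunctionalCalculus.

(** [f] is a function on the whole line of which only the values on
    [(0, +oo)] matter, here and in [D1]. *)
Definition C2_pos (R : realType) (f : R -> R) : Prop :=
  forall x : R, 0 < x ->
    [/\ derivable f x 1, derivable f^`() x 1 & {for x, continuous f^`(2)}].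

(** The equality of norms presupposes that the Frechet derivative exists. *)
Definition D1 (R : realType) (H : hilbertType R) (f : R -> R) : Prop :=
  forall A : sa H, posdef A ->
    differentiable (cfc f) A /\ superopnorm ('d (cfc f) A) = `|cfc f^`() A|.

Section RiemannIntegral.
Context {R : realType} {V : normedModType R}.

(** Sum for the subdivision [a :: s] with tags [xi]. *)
Definition riemann_sum (F : R -> V) (a : R) (s : seq R) (xi : nat -> R) : V :=
  \sum_(0 <= i < size s) (s`_i - (a :: s)`_i) *: F (xi i).

(** Norm limit of the Riemann sums as the mesh tends to [0]. *)
Definition is_riemann_integral (F : R -> V) (a b : R) (J : V) : Prop :=
  forall e : R, 0 < e -> exists2 d : R, 0 < d &
    forall (s : seq R) (xi : nat -> R), itv_partition a b s ->
      (forall i, (i < size s)%N ->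
         (a :: s)`_i <= xi i <= s`_i /\ s`_i - (a :: s)`_i < d) ->
      `|riemann_sum F a s xi - J| < e.

Definition riemann_integral (F : R -> V) (a b : R) : V :=
  get (is_riemann_integral F a b).

End RiemannIntegral.

(* Main.v *)
From HB Require Import structures.
Require Import Defs.
From mathcomp Require Import all_boot all_order all_algebra.
From mathcomp Require Import complex ring lra.
From mathcomp Require Import all_classical all_reals all_analysis.
Import Order.TTheory GRing.Theory Num.Theory.
Import numFieldNormedType.Exports.

Local Open Scope ring_scope.
Local Open Scope classical_set_scope.

(** Let [g t] be the value of the functional calculus of [f] at the point
    [(1 - t) *: A + t *: B] of the segment. Integration by parts turns the left
    hand side into the integral over the unit segment of [(t - nu) *: g' t],
    and [`|g' t|] is at most [`|f'((1 - t) *: A + t *: B)| * `|B - A|], because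
    [g' t] is the Frechet derivative of the functional calculus applied to
    [B - A], and its norm is prescribed by [D1] ([segment_derivative]).
    Convexity bounds this by a function [psi t] of the values at [A] and [B],
    and the constants are the integrals of [`|t - nu| * psi t].

    The derivative [g'] need not be integrated: if [Q] is a primitive of [g],
    then [G t = (t - nu) *: g t - Q t] has derivative [(t - nu) *: g' t], and
    the mean value inequality for vector valued functions ([mean_value])
    compares it with a primitive of [(t - nu) * psi t]
    ([weighted_trapezoid_le]). For (i) that primitive is a multiple of
    [(t - nu) ^+ 2], for (ii) it is a sum of two [moment]s.

    Three facts make this legitimate. A convex combination of positive definite
    operators is positive definite, spectrum included ([posdef_segment]): such
    operators are exactly the coercive ones, a coercive operator being
    invertible by the Neumann series ([coercive_unit]). The space of
    self-adjoint operators is complete ([sa_complete]). A continuous function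
    into a complete space therefore has a primitive on the unit segment, as a
    limit of primitives of step functions ([continuous_primitive]), and its
    Riemann integral is the increment of that primitive
    ([riemann_integralE]). *)

(** * Norm, inner product and bounded operators *)

Section Hilbert.
Context {R : realType} {H : hilbertType R}.
Implicit Types (x y z : H) (A B T : bop H).
Local Open Scope complex_scope.

(** The norm of [H] and the inner product take their values in [R[i]]; their
    real parts carry all the estimates, and can be fed to real arithmetic. *)
Definition rnorm x : R := complex.Re `|x|.
Definition rdot x y : R := complex.Re (inner x y).

Lemma rnormE x : (rnorm x)%:C = `|x|.
Proof. by rewrite RRe_real. Qed.

Lemma rnorm_ge0 x : 0 <= rnorm x.
Proof. by rewrite -lecR rnormE normr_ge0. Qed.

Lemma rnormD x y : rnorm (x + y) <= rnorm x + rnorm y.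
Proof. by rewrite -lecR rmorphD/= !rnormE ler_normD. Qed.

Lemma rnorm0 : rnorm 0 = 0.
Proof. by apply: complexI; rewrite rnormE normr0. Qed.

Lemma rdotxx x : rdot x x = rnorm x ^+ 2.
Proof.
apply: complexI; rewrite rmorphXn/= rnormE -inner_norm RRe_real//.
by rewrite inner_norm rpredX ?normr_real.
Qed.

Lemma rdotC x y : rdot x y = rdot y x.
Proof.
have ReJ (z : R[i]) : complex.Re (Num.conj z) = complex.Re z by case: z.
by rewrite /rdot hermC expr0 mul1r ReJ.
Qed.

Lemma rdotDl x y z : rdot (x + y) z = rdot x z + rdot y z.
Proof. by rewrite /rdot linearDl; exact: (raddfD (@complex.Re R : Rcomplex R -> R)). Qed.

Lemma rdotDr x y z : rdot x (y + z) = rdot x y + rdot x z.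
Proof. by rewrite ![rdot x _]rdotC rdotDl. Qed.

Lemma rdotNl x y : rdot (- x) y = - rdot x y.
Proof. by rewrite /rdot linearNl; exact: (raddfN (@complex.Re R : Rcomplex R -> R)). Qed.

Lemma rdotNr x y : rdot x (- y) = - rdot x y.
Proof. by rewrite ![rdot x _]rdotC rdotNl. Qed.

Lemma rdotZl (r : R) x y : rdot (r%:C *: x) y = r * rdot x y.
Proof.
have ReZ (z : R[i]) : complex.Re (r%:C * z) = r * complex.Re z.
  by case: z => a b /=; rewrite mul0r subr0.
by rewrite /rdot linearZl_LR ReZ.
Qed.

Lemma rdotZr (r : R) x y : rdot x (r%:C *: y) = r * rdot x y.
Proof. by rewrite ![rdot x _]rdotC rdotZl. Qed.

(** The Cauchy-Schwarz inequality is the triangle inequality for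
    [rnorm (x + y)], squared. *)
Lemma rdot_le x y : rdot x y <= rnorm x * rnorm y.
Proof.
have : rnorm (x + y) ^+ 2 <= (rnorm x + rnorm y) ^+ 2.
  by rewrite ler_pXn2r// ?nnegrE ?rnormD// ?addr_ge0// ?rnorm_ge0.
rewrite -!rdotxx rdotDl !rdotDr !rdotxx (rdotC y x); nra.
Qed.

Lemma bopN T x : T (- x) = - T x.
Proof.
have T0 : T 0 = 0.
  by have := bop_linear T (-1) 0 0; rewrite scaler0 addr0 scaleN1r addNr.
by have := bop_linear T (-1) x 0; rewrite T0 !addr0 !scaleN1r.
Qed.

Lemma bopD T x y : T (x + y) = T x + T y.
Proof. by have := bop_linear T 1 x y; rewrite !scale1r. Qed.

Lemma bopB T x y : T (x - y) = T x - T y.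
Proof. by rewrite bopD bopN. Qed.

Lemma bopZ T (a : R[i]) x : T (a *: x) = a *: T x.
Proof.
have := bop_linear T a x 0; rewrite addr0 => ->.
by rewrite -[T 0](addrK (T 0)) -bopD addr0 subrr addr0.
Qed.

Lemma rnorm_bop T x : rnorm (T x) <= opnorm T * rnorm x.
Proof. by rewrite -lecR rmorphM/= !rnormE le_opnorm. Qed.

Lemma opnorm_ler T (M : R) :
  0 <= M -> (forall x, rnorm (T x) <= M * rnorm x) -> opnorm T <= M.
Proof.
move=> M0 TM; apply: opnorm_le => // x.
by rewrite -!rnormE -rmorphM lecR.
Qed.

Lemma opnormN A : opnorm (- A) = opnorm A.
Proof.
have -> : - A = (-1)%:C *: A by rewrite (rmorphN1 (real_complex R)) scaleN1r.
by rewrite opnormZ normrN1 mul1r.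
Qed.

Lemma opnormM A B : opnorm (A * B) <= opnorm A * opnorm B.
Proof.
apply: opnorm_ler => [|x]; first by rewrite mulr_ge0 ?opnorm_ge0.
rewrite (le_trans (rnorm_bop A (B x)))// -mulrA ler_wpM2l ?opnorm_ge0//.
exact: rnorm_bop.
Qed.

Lemma opnormX A n : opnorm (A ^+ n) <= opnorm A ^+ n.
Proof.
elim: n => [|n ih].
  by rewrite !expr0; apply: opnorm_ler => // x; rewrite mul1r.
rewrite !exprS (le_trans (opnormM _ _))// ler_wpM2l ?opnorm_ge0//.
Qed.

(** The limit operator is the pointwise limit; the Cauchy bounds pass to it.
    The index filter is arbitrary, so that this serves both for the partial
    sums of a series and for Cauchy filters of operators. *)
Lemma bop_complete (I : Type) (F : set_system I) {FF : ProperFilter F}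
    (S : I -> bop H) :
  (forall e : R, 0 < e -> exists2 P, F P &
     forall i j, P i -> P j -> opnorm (S i - S j) <= e) ->
  exists L : bop H, forall e : R, 0 < e ->
    exists2 P, F P & forall i, P i -> opnorm (S i - L) <= e.
Proof.
move=> cS.
have cvS x : cvg (S i x @[i --> F]).
  apply: cauchy_cvg; apply: cauchy_exP => e e0.
  have er : 0 < complex.Re e.
    by move: e0; rewrite ltcE => /andP[].
  have eE : e = (complex.Re e)%:C by rewrite RRe_real// gtr0_real.
  have d0 : 0 < complex.Re e / (rnorm x + 1).
    by rewrite divr_gt0// ltr_wpDl// rnorm_ge0.
  have [P FP PS] := cS _ d0.
  have [i Pi] := filter_ex FP.
  exists (S i x); rewrite /= nbhs_simpl/=.
  apply: filterS FP => j Pj.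
  rewrite -ball_normE/= eE -[S i x - S j x]/((S i - S j) x) -rnormE ltcR.
  apply: le_lt_trans (rnorm_bop _ _) _.
  apply: le_lt_trans (ler_wpM2r (rnorm_ge0 x) (PS _ _ Pi Pj)) _.
  rewrite mulrAC ltr_pdivrMr ?ltr_wpDl ?rnorm_ge0//.
  by rewrite ltr_pM2l// ltrDl.
pose l x : H := lim (S i x @[i --> F]).
have ll x : S i x @[i --> F] --> l x by exact: cvS.
have lP (e : R) P x : (forall i j, P i -> P j -> opnorm (S i - S j) <= e) ->
    F P -> forall i, P i -> `|S i x - l x| <= (e * rnorm x)%:C.
  move=> PS FP i Pi.
  have /cvgrPdist_le cv := ll x; apply/ler_addgt0Pr => e' e'0.
  have [j [Pj le1]] := filter_ex (filterI FP (cv _ e'0)).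
  rewrite (le_trans (ler_distD (S j x) _ _))// lerD//; last by rewrite distrC.
  rewrite -[S i x - S j x]/((S i - S j) x) -rnormE lecR.
  by rewrite (le_trans (rnorm_bop _ _))// ler_wpM2r ?rnorm_ge0// PS.
have linl : linear l.
  move=> a x y; rewrite [LHS]/l; apply: cvg_lim => //.
  have -> : (fun i => S i (a *: x + y)) = (fun i => a *: S i x + S i y).
    by apply/funext => i; rewrite bop_linear.
  by apply: cvgD => //; apply: cvgZr.
have bl : l \in @bounded_operator R H.
  have [P FP PS] := cS _ ltr01.
  have [i Pi] := filter_ex FP.
  apply/boundedP; split=> //; exists (opnorm (S i) + 1).
    by rewrite addr_ge0// opnorm_ge0.
  move=> x; have := lP _ _ x PS FP _ Pi; rewrite -!rnormE -rmorphM/= !lecR.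
  move=> h; rewrite -[l x](subrK (S i x)) (le_trans (rnormD _ _))//.
  rewrite addrC mulrDl lerD ?rnorm_bop//.
  suff -> : rnorm (l x - S i x) = rnorm (S i x - l x) by [].
  by rewrite /rnorm distrC.
exists (Bop bl) => e e0; have [P FP PS] := cS _ e0; exists P => // i Pi.
apply: opnorm_le => [|x]; first exact: ltW.
rewrite -[`|x|]rnormE -rmorphM; exact: lP FP _ Pi.
Qed.

(** The partial sums [S n] of the Neumann series commute with [1 - K] and
    satisfy [(1 - K) * S n = 1 - K ^+ n]; the bound
    [(1 - q) * opnorm (S (n + m) - S n) <= q ^+ n * (1 - q ^+ m)] makes them
    converge. *)
Lemma neumann (K : bop H) (q : R) : opnorm K <= q -> q < 1 ->
  exists S : bop H, S * (1 - K) = 1 /\ (1 - K) * S = 1.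
Proof.
move=> Kq q1; have q0 : 0 <= q by apply: le_trans Kq; exact: opnorm_ge0.
have KX n : opnorm (K ^+ n) <= q ^+ n.
  by rewrite (le_trans (opnormX _ _))// lerXn2r// nnegrE opnorm_ge0.
pose S n : bop H := \sum_(i < n) K ^+ i.
have SS n m : (1 - q) * opnorm (S (n + m)%N - S n) <= q ^+ n * (1 - q ^+ m).
  rewrite /S big_split_ord/= addrAC subrr add0r.
  elim: m => [|m ih].
    by rewrite big_ord0 expr0 subrr mulr0 (_ : opnorm 0 = 0) ?mulr0//;
       apply/eqP; rewrite eq_le opnorm_ge0 andbT; apply: opnorm_ler => // x;
       rewrite rnorm0 mul0r.
  rewrite big_ord_recr/=.
  have := opnormD (\sum_(i < m) K ^+ (n + i)) (K ^+ (n + m)).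
  have := KX (n + m)%N; rewrite [q ^+ (n + m)]exprD [q ^+ m.+1]exprS.
  set a := opnorm (\sum_(i < m) _) in ih *; set b := opnorm (K ^+ _).
  set c := opnorm _.
  set u := q ^+ m in ih *; set v := q ^+ n in ih * => bv cab.
  have /le_trans : (1 - q) * c <= (1 - q) * (a + v * u).
    by rewrite ler_wpM2l ?subr_ge0 ?(ltW q1)// (le_trans cab)// lerD2l.
  apply; lra.
have qe (e : R) : 0 < e -> exists2 N, q ^+ N < e & True.
  move=> e0; have := @cvg_expr R q; rewrite ger0_norm// => /(_ q1).
  move=> /cvgrPdist_lt/(_ e e0) [N _ /(_ N (leqnn N))] /=.
  by rewrite sub0r normrN ger0_norm ?exprn_ge0// => ?; exists N.
have [|L LS] := @bop_complete nat \oo _ S.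
  move=> e e0; have [|N qN _] := qe (e * (1 - q) / 2).
    by rewrite divr_gt0// mulr_gt0// subr_gt0.
  exists [set n | (N <= n)%N]; first by exists N.
  move=> i j /= /subnKC <- /subnKC <-.
  set a := (i - N)%N; set b := (j - N)%N.
  have -> : S (N + a)%N - S (N + b)%N = (S (N + a)%N - S N) - (S (N + b)%N - S N).
    by rewrite opprB addrA subrK.
  rewrite (le_trans (opnormD _ _))// opnormN.
  rewrite -(@ler_pM2l _ (1 - q)) ?subr_gt0// mulrDr.
  have := SS N a; have := SS N b.
  set u := opnorm _; set v := opnorm _.
  have : 0 <= q ^+ N by rewrite exprn_ge0.
  have : 0 <= q ^+ a by rewrite exprn_ge0.
  have : 0 <= q ^+ b by rewrite exprn_ge0.
  nra.
have lim0 (B : bop H) : (forall e : R, 0 < e -> opnorm B <= e) -> B = 0.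
  move=> Be; apply: opnorm_eq0; apply/eqP; rewrite eq_le opnorm_ge0 andbT.
  by apply/ler_addgt0Pr => e /Be; rewrite add0r.
have comm n : S n * (1 - K) = (1 - K) * S n.
  rewrite /S mulr_suml mulr_sumr; apply: eq_bigr => i _.
  by rewrite mulrBl mulrBr mul1r mulr1 -exprS -exprSr.
have SK n : (1 - K) * S n = 1 - K ^+ n.
  by rewrite -opprB mulNr -subrX1 opprB.
have oK : opnorm (1 - K) <= 2.
  rewrite (le_trans (opnormD _ _))// -[2]/(1+1) lerD//.
    by have := opnormX K 0; rewrite !expr0.
  by rewrite opnormN (le_trans Kq)// ltW.
have key e : 0 < e -> exists n, opnorm (S n - L) <= e /\ opnorm (K ^+ n) <= e.
  move=> e0; have [P [N _ NP] PS] := LS _ e0; have [M Me _] := qe _ e0.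
  exists (N + M)%N; split; first by apply: PS; apply: NP => /=; rewrite leq_addr.
  rewrite (le_trans (KX _))// (le_trans _ (ltW Me))// exprD.
  by rewrite ler_piMl ?exprn_ge0// exprn_ile1// ltW.
exists L; split; apply/subr0_eq/lim0 => e e0.
  have [|n [Sn Kn]] := key (e / 3); first lra.
  have -> : L * (1 - K) - 1 = - ((S n - L) * (1 - K) + K ^+ n).
    rewrite mulrBl comm SK.
    by rewrite addrAC subrK opprB.
  rewrite opnormN (le_trans (opnormD _ _))//.
  have := opnormM (S n - L) (1 - K).
  have := opnorm_ge0 (S n - L); have := opnorm_ge0 (1 - K); nra.
have [|n [Sn Kn]] := key (e / 3); first lra.
have -> : (1 - K) * L - 1 = - ((1 - K) * (S n - L) + K ^+ n).
  rewrite mulrBr SK.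
  by rewrite addrAC subrK opprB.
rewrite opnormN (le_trans (opnormD _ _))//.
have := opnormM (1 - K) (S n - L).
have := opnorm_ge0 (S n - L); have := opnorm_ge0 (1 - K); nra.
Qed.

End Hilbert.

(** * Positive definite operators *)

Section Positive.
Context {R : realType} {H : hilbertType R}.
Implicit Types (x y : H) (T : bop H) (A B : sa H).
Local Open Scope complex_scope.

(** A Lax-Milgram argument: for small [rho] the operator [1 - rho *: T] is a
    contraction, because
    [rnorm (x - rho *: T x) ^+ 2 <= (1 - 2 * rho * c + (rho * M) ^+ 2)
     * rnorm x ^+ 2] when [M] bounds [T]. The Neumann series then inverts
    [rho *: T]. *)
Lemma coercive_unit T (c : R) : 0 < c ->
  (forall x, c * rnorm x ^+ 2 <= rdot (T x) x) ->
  exists S : bop H, S * T = 1 /\ T * S = 1.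
Proof.
move=> c0 Tc; pose M := opnorm T + c; have T0 := opnorm_ge0 T.
have M0 : 0 < M by rewrite ltr_wpDl.
(* rho minimises 1 - 2 rho c + (rho M)^2, whose minimum is 1 - d below *)
pose rho := c / M ^+ 2.
have rho0 : 0 < rho by rewrite divr_gt0// exprn_gt0.
pose K : bop H := 1 - rho%:C *: T.
pose d := c ^+ 2 / M ^+ 2.
have d01 : 0 < d <= 1.
  rewrite divr_gt0 ?exprn_gt0//= ler_pdivrMr ?exprn_gt0// mul1r.
  by rewrite ler_pXn2r// ?nnegrE ?(ltW M0) ?(ltW c0)// lerDr.
have KE x : rnorm (K x) ^+ 2 <= (1 - d) * rnorm x ^+ 2.
  have -> : K x = x - rho%:C *: T x by [].
  rewrite -rdotxx rdotDl !rdotDr !rdotNl !rdotNr rdotZl !rdotZr rdotZl.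
  rewrite (rdotC x (T x)) !rdotxx.
  have : rnorm (T x) ^+ 2 <= M ^+ 2 * rnorm x ^+ 2.
    rewrite -exprMn ler_pXn2r// ?nnegrE ?mulr_ge0 ?rnorm_ge0// ?(ltW M0)//.
    by rewrite (le_trans (rnorm_bop _ _))// ler_wpM2r ?rnorm_ge0// lerDl (ltW c0).
  have := Tc x; set t := rnorm (T x) ^+ 2; set n := rnorm x ^+ 2; set r := rdot _ _.
  move=> cr tM.
  have rM : rho * M ^+ 2 = c by rewrite /rho divfK// expf_neq0// gt_eqF.
  have rc : rho * c = d by rewrite /rho /d expr2 mulrAC.
  have h1 : rho * (c * n) <= rho * r by rewrite ler_pM2l.
  have h2 : rho * (rho * t) <= rho * (rho * (M ^+ 2 * n)).
    by rewrite !ler_pM2l.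
  have h3 : rho * (rho * (M ^+ 2 * n)) = d * n.
    by rewrite (mulrA rho (M ^+ 2)) rM mulrA rc.
  rewrite mulrA rc in h1; rewrite h3 in h2; lra.
have [||S [SK KS]] := @neumann R H K (Num.sqrt (1 - d)).
- apply: opnorm_ler => [|x]; first exact: sqrtr_ge0.
  rewrite -(@ler_pXn2r _ 2)// ?nnegrE ?mulr_ge0 ?sqrtr_ge0 ?rnorm_ge0//.
  by rewrite exprMn sqr_sqrtr ?KE//; lra.
- by rewrite -[ltRHS]sqrtr1 ltr_sqrt//; lra.
have EK : 1 - K = rho%:C *: T by rewrite /K opprB addrC subrK.
rewrite EK in SK KS; exists (rho%:C *: S); split; apply: bopP => x.
  by rewrite -[RHS](congr1 (fun B : bop H => B x) SK) /= bopZ.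
by rewrite -[RHS](congr1 (fun B : bop H => B x) KS) /= bopZ.
Qed.

Lemma rdot_sa A x y : rdot (A x) y = rdot x (A y).
Proof.
have /selfadjointP sA := valP A; rewrite /rdot; congr complex.Re.
exact: sA.
Qed.

Lemma inner_sa_real A x : inner (A x) x = (rdot (A x) x)%:C.
Proof.
have /selfadjointP sA := valP A.
have : Num.conj (inner (A x) x) = inner (A x) x.
  by rewrite [RHS]sA [RHS]hermC expr0 mul1r.
by move=> /CrealP h; rewrite /rdot RRe_real.
Qed.

(** Expanding [0 <= rdot (A z) z] at [z = x - M^-1 *: A x] gives
    [rnorm (A x) ^+ 2 <= M * rdot (A x) x]; as 0 is not in the spectrum, [A]
    has an inverse [B], and [rnorm x <= opnorm B * rnorm (A x)]. *)
Lemma posdef_coercive A : posdef A ->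
  exists2 c : R, 0 < c & forall x, c * rnorm x ^+ 2 <= rdot (A x) x.
Proof.
move=> [Apos Aspec].
have pos x : 0 <= rdot (A x) x.
  have [->|x0] := eqVneq x 0; first by rewrite /rdot linear0r.
  by have := Apos x x0; rewrite inner_sa_real ltcR => /ltW.
have [B [BA _]] : exists B : bop H,
    B * ((A : bop H) - 0 *: (1 : bop H)) = 1 /\
    ((A : bop H) - 0 *: (1 : bop H)) * B = 1.
  apply: contrapT => /Aspec[r /=]; rewrite in_itv/= andbT => r0 [rE].
  by rewrite rE ltxx in r0.
rewrite scale0r subr0 in BA.
(* the summands 1 only keep M and N positive when H is the zero space *)
pose M := opnorm A + 1; pose N := opnorm B + 1.
have M0 : 0 < M by rewrite ltr_wpDl// opnorm_ge0.
have N0 : 0 < N by rewrite ltr_wpDl// opnorm_ge0.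
exists (M * N ^+ 2)^-1 => [|x]; first by rewrite invr_gt0 mulr_gt0// exprn_gt0.
have h1 : rnorm x <= N * rnorm (A x).
  have -> : x = B (A x) by rewrite -[LHS](congr1 (fun C : bop H => C x) BA).
  rewrite (le_trans (rnorm_bop _ _))//.
  have <- : x = B (A x) by rewrite -[LHS](congr1 (fun C : bop H => C x) BA).
  by rewrite ler_wpM2r ?rnorm_ge0// lerDl.
have h2 : rnorm (A x) ^+ 2 <= M * rdot (A x) x.
  have := pos (x - M^-1%:C *: A x).
  rewrite bopB bopZ rdotDl !rdotDr !rdotNl !rdotNr !rdotZl !rdotZr.
  rewrite (rdot_sa A (A x) x) !rdotxx.
  have := rdot_le (A (A x)) (A x).
  have : rnorm (A (A x)) <= M * rnorm (A x).
    rewrite (le_trans (rnorm_bop _ _))//.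
    by rewrite ler_wpM2r ?rnorm_ge0// lerDl.
  move=> a1 a2 a3.
  have a4 : rdot (A (A x)) (A x) <= M * rnorm (A x) ^+ 2.
    by rewrite (le_trans a2)// expr2 mulrA ler_wpM2r ?rnorm_ge0.
  have a5 : M^-1 * (M^-1 * rdot (A (A x)) (A x)) <= M^-1 * rnorm (A x) ^+ 2.
    by rewrite ler_pM2l ?invr_gt0// ler_pdivrMl.
  by rewrite -ler_pdivrMl//; lra.
rewrite ler_pdivrMl ?mulr_gt0 ?exprn_gt0//.
have h3 : rnorm x ^+ 2 <= N ^+ 2 * rnorm (A x) ^+ 2.
  by rewrite -exprMn ler_pXn2r// nnegrE ?mulr_ge0 ?rnorm_ge0 ?(ltW N0).
rewrite (le_trans h3)// (mulrC M) -(mulrA (N ^+ 2)) ler_wpM2l//.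
by rewrite exprn_ge0// ltW.
Qed.

(** Off the positive half-line, [A - l] is coercive up to a factor: 1 if [l] is
    real, and ['i] or [- 'i] according to the sign of the imaginary part of [l]
    otherwise. *)
Lemma coercive_posdef A (c : R) : 0 < c ->
  (forall x, c * rnorm x ^+ 2 <= rdot (A x) x) -> posdef A.
Proof.
move=> c0 Ac; split=> [x x0|[a b] /=].
  rewrite inner_sa_real ltcR (lt_le_trans _ (Ac x))// mulr_gt0// exprn_gt0//.
  by rewrite lt_neqAle rnorm_ge0 andbT eq_sym -(inj_eq (@complexI R)) rnormE normr_eq0.
move=> sp; apply: contrapT => nab; apply: sp.
set T : bop H := _ - _.
have TE x : T x = A x - (a +i* b) *: x by [].
(* rdot (A x) x is real: after multiplication by e * 'i, with e = 1 or -1, the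
   real part only sees e * b *)
have rot (e : R) : e ^+ 2 = 1 -> 0 < e * b ->
    exists B : bop H, B * T = 1 /\ T * B = 1.
  move=> e1 eb.
  pose w : R[i] := 0 +i* e.
  have [x|S [ST TS]] := @coercive_unit (w *: T) (e * b) eb.
    have -> : rdot ((w *: T) x) x = e * b * rnorm x ^+ 2.
      have E : inner (T x) x =
          (rdot (A x) x)%:C - (a +i* b) * (rnorm x ^+ 2)%:C.
        rewrite TE linearBl linearZl_LR/= inner_sa_real inner_norm -rnormE.
        by rewrite rmorphXn.
      rewrite {1}/rdot.
      have -> : inner ((w *: T) x) x = w * inner (T x) x by exact: linearZl_LR.
      by rewrite E/=; ring.
    by [].
  exists (w *: S); split; apply: bopP => x.
    have := congr1 (fun B : bop H => B x) ST.
    by rewrite -[X in X = _ -> _]/(S (w *: T x)) bopZ.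
  have := congr1 (fun B : bop H => B x) TS.
  by rewrite -[X in X = _ -> _]/(w *: T (S x)) -bopZ.
have [b0|b0|b0] := ltrgtP b 0.
- by apply: (rot (-1)); rewrite ?sqrrN ?expr1n// mulN1r oppr_gt0.
- by apply: (rot 1); rewrite ?expr1n// mul1r.
have a0 : a <= 0.
  rewrite leNgt; apply/negP => a0; apply: nab; exists a; last by rewrite b0.
  by rewrite /= in_itv/= andbT.
apply: (@coercive_unit T c) => // x.
rewrite TE b0 rdotDl rdotNl rdotZl rdotxx (le_trans (Ac x))// lerDl.
by rewrite oppr_ge0 mulr_le0_ge0// exprn_ge0// rnorm_ge0.
Qed.

Lemma posdef_sigma A : posdef A -> sigma `]0, +oo[ A.
Proof. by case. Qed.

(** The spectral half of [posdef] is not visibly convex, but coercivity is. *)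
Lemma posdef_segment A B (t : R) : posdef A -> posdef B -> 0 <= t <= 1 ->
  posdef ((1 - t) *: A + t *: B).
Proof.
move=> /posdef_coercive[c c0 Ac] /posdef_coercive[d d0 Bd] /andP[t0 t1].
apply: (@coercive_posdef _ (Num.min c d)) => [|x].
  by rewrite lt_min c0 d0.
have -> : ((1 - t) *: A + t *: B) x = (1 - t)%:C *: A x + t%:C *: B x by [].
rewrite rdotDl !rdotZl.
have n0 : 0 <= rnorm x ^+ 2 by rewrite exprn_ge0// rnorm_ge0.
have hA : Num.min c d * rnorm x ^+ 2 <= rdot (A x) x.
  by rewrite (le_trans _ (Ac x))// ler_wpM2r// ge_min lexx.
have hB : Num.min c d * rnorm x ^+ 2 <= rdot (B x) x.
  by rewrite (le_trans _ (Bd x))// ler_wpM2r// ge_min lexx orbT.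
have -> : Num.min c d * rnorm x ^+ 2 =
    (1 - t) * (Num.min c d * rnorm x ^+ 2) + t * (Num.min c d * rnorm x ^+ 2).
  by rewrite -mulrDl subrK mul1r.
by rewrite lerD// ler_wpM2l// subr_ge0.
Qed.

End Positive.

(** * Completeness of the self-adjoint operators *)

Section Complete.
Context {R : realType} {H : hilbertType R}.
Local Open Scope complex_scope.

(** Self-adjointness survives norm limits. It is checked on real parts first;
    the imaginary part of [inner u v] is minus the real part of
    [inner ('i *: u) v]. *)
Lemma sa_complete (F : set_system (sa H)) :
  ProperFilter F -> cauchy F -> cvg F.
Proof.
move=> FF cF.
have [|L SL] := @bop_complete R H (sa H) F FF (@sa_op R H).
  move=> e e0.
  have e20 : 0 < e / 2 by rewrite divr_gt0.
  have [A FA] := (cauchyP F).1 cF _ e20.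
  exists (ball A (e / 2)) => // B C; rewrite -ball_normE/= => AB AC.
  have -> : (B : bop H) - (C : bop H) = ((B - A) + (A - C) : sa H).
    by rewrite addrA subrK.
  change (`|(B - A) + (A - C)| <= e).
  rewrite (le_trans (ler_normD _ _))// [e]splitr lerD//.
    by rewrite distrC ltW.
  exact: ltW.
have rL x y : rdot (L x) y <= rdot x (L y).
  apply/ler_addgt0Pr => e e0.
  pose C := rnorm x * rnorm y + 1.
  have C0 : 0 < C by rewrite ltr_wpDl// mulr_ge0 ?rnorm_ge0.
  have d0 : 0 < e / 2 / C by rewrite !divr_gt0.
  have [P FP PL] := SL _ d0; have [A PA] := filter_ex FP.
  have h1 := rdot_le (((L : bop H) - A) x) y.
  have h2 := rdot_le x (((A : bop H) - L) y).
  have LA : opnorm (L - (A : bop H)) <= e / 2 / C by rewrite -opprB opnormN PL.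
  have k1 := rnorm_bop (L - (A : bop H)) x.
  have k2 := rnorm_bop ((A : bop H) - L) y.
  have {}h1 : rdot (L x) y - rdot (A x) y <= e / 2 / C * rnorm x * rnorm y.
    rewrite -rdotNl -rdotDl (le_trans h1)// ler_wpM2r ?rnorm_ge0//.
    by rewrite (le_trans k1)// ler_wpM2r ?rnorm_ge0.
  have {}h2 : rdot x (A y) - rdot x (L y) <= rnorm x * (e / 2 / C * rnorm y).
    rewrite -rdotNr -rdotDr (le_trans h2)// ler_wpM2l ?rnorm_ge0//.
    by rewrite (le_trans k2)// ler_wpM2r ?rnorm_ge0 ?PL.
  have : e / 2 / C * (rnorm x * rnorm y) <= e / 2.
    rewrite mulrAC ler_pdivrMr// ler_pM2l ?divr_gt0// lerDl ler01//.
  rewrite (rdot_sa A x y) in h1; lra.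
have rLE x y : rdot (L x) y = rdot x (L y).
  by apply/eqP; rewrite eq_le rL/= rdotC [leRHS]rdotC rL.
have saL : L \in @selfadjoint R H.
  apply/selfadjointP => x y.
  have ImE u v : complex.Im (inner u v) = - rdot ('i *: u) v.
    rewrite /rdot; have -> : inner ('i *: u) v = 'i * inner u v.
      exact: linearZl_LR.
    by case: (inner u v) => a b /=; rewrite mul0r mul1r sub0r opprK.
  apply/eqP; rewrite eq_complex; apply/andP; split; apply/eqP.
    exact: rLE.
  by rewrite !ImE -bopZ rLE.
apply/cvg_ex; exists (Sa saL).
apply/cvgrPdist_le => e e0; have [P FP PL] := SL e e0.
apply: filterS FP => A PA; rewrite distrC; exact: PL.
Qed.

HB.instance Definition _ := Uniform_isComplete.Build (sa H) sa_complete.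
End Complete.

(** * The mean value inequality *)

Section MeanValue.
Context {R : realType}.

(** Continuous induction: a transitive relation that holds between points on
    either side of [c] and close to it, for every [c], holds between the ends
    of the segment. The supremum of the points related to [a] must be [b]. *)
Lemma segment_chain (a b : R) (Q : R -> R -> Prop) : a <= b ->
  (forall x y z, a <= x <= y -> y <= z <= b -> Q x y -> Q y z -> Q x z) ->
  (forall c, a <= c <= b -> exists2 d : R, 0 < d &
     forall x y, a <= x <= c -> c <= y <= b -> y - x < d -> Q x y) ->
  Q a b.
Proof.
move=> ab Qtr Qloc.
pose S := [set t | a <= t <= b /\ Q a t].
have Sa : S a.
  split; first by rewrite lexx.
  by have [|d d0] := Qloc a; rewrite ?lexx//; apply; rewrite ?lexx// subrr.
have supS : has_sup S.
  by split; [exists a|exists b => t [/andP[]]].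
pose c := sup S.
have cab : a <= c <= b.
  by rewrite ub_le_sup// ?ge_sup//; [exists a|move=> t [/andP[]]|case: supS].
have /andP[ac cb] := cab.
have [d d0 Qc] := Qloc c cab.
have d20 : 0 < d / 2 by rewrite divr_gt0.
have [x [xab Qax] cx] := sup_adherent d20 supS; rewrite -/c in cx.
have /andP[ax xb] := xab.
have xc : x <= c by apply: ub_le_sup => //; case: supS.
pose y := Num.min b (c + d / 2).
have cy : c <= y by rewrite le_min cb lerDl ltW.
have yb : y <= b by rewrite ge_min lexx.
have Qay : Q a y.
  have [ay|ay] := ltP a y; last first.
    have -> : y = a by apply/eqP; rewrite eq_le ay (le_trans ac).
    by case: Sa.
  apply: (Qtr _ x) => //; rewrite ?lexx ?(le_trans xc)//.
  apply: Qc; rewrite ?ax ?xc ?cy ?yb//.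
  have : y <= c + d / 2 by rewrite ge_min lexx orbT.
  lra.
have yc : y <= c.
  by apply: ub_le_sup; [case: supS|split=> //; rewrite yb (le_trans ac)].
have [bd|bd] := leP b (c + d / 2); first by move: Qay; rewrite /y min_l.
by move: yc; rewrite /y min_r ?(ltW bd)//; lra.
Qed.

Lemma increment_le {V : normedModType R} (F : R -> V) (e a b d : R) : 0 < d ->
  (forall x y, a <= x -> x <= y -> y <= b -> y - x < d ->
    `|F y - F x| <= e * (y - x)) ->
  forall x y, a <= x -> x <= y -> y <= b -> `|F y - F x| <= e * (y - x).
Proof.
move=> d0 Fd x y ax xy yb.
apply: (@segment_chain x y (fun u v => `|F v - F u| <= e * (v - u))) => //.
  move=> u v w _ _ uv vw; rewrite -(subrK (F v) (F w)) -addrA.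
  rewrite (le_trans (ler_normD _ _))// (le_trans (lerD vw uv))//.
  by rewrite -mulrDr addrA subrK.
move=> c _; exists d => // u v /andP[xu uc] /andP[cv vy] uvd.
by apply: Fd => //; [exact: le_trans xu|exact: le_trans cv|exact: le_trans yb].
Qed.

Lemma derivable_expansion {V : normedModType R} (F : R -> V) (c e : R) :
  derivable F c 1 -> 0 < e ->
  exists2 d : R, 0 < d & forall t, `|t - c| < d ->
    `|F t - F c - (t - c) *: 'D_1 F c| <= e * `|t - c|.
Proof.
move=> dF e0.
have /cvgrPdist_le /(_ e e0) [d d0 Fd] := dF.
exists d => // t td.
have [->|tc] := eqVneq t c; first by rewrite !subrr scale0r subrr !normr0 mulr0.
have tc0 : t - c != 0 by rewrite subr_eq0.
have := Fd (t - c); rewrite /ball_/= sub0r normrN => /(_ td tc0).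
rewrite scaler1 subrK distrC => tF.
have -> : F t - F c - (t - c) *: 'D_1 F c =
    (t - c) *: ((t - c)^-1 *: (F t - F c) - 'D_1 F c).
  by rewrite scalerBr scalerA divff// scale1r.
by rewrite normrZ mulrC ler_wpM2r.
Qed.

(** Up to [e * (y - x)], the estimate to be proved is a transitive relation
    between [x] and [y], and first-order expansions at [c] give it between two
    close points on either side of [c]. *)
Lemma mean_value_closed {V : normedModType R} (F : R -> V) (h : R -> R) (a b : R) :
  a <= b ->
  (forall t, a <= t <= b ->
     [/\ derivable F t 1, derivable h t 1 & `|'D_1 F t| <= 'D_1 h t]) ->
  `|F b - F a| <= h b - h a.
Proof.
move=> ab Fh; apply/ler_addgt0Pr => e' e'0.
pose e := e' / (b - a + 1).
have ba1 : 0 < b - a + 1 by rewrite ltr_wpDl// subr_ge0.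
have e0 : 0 < e by rewrite divr_gt0.
suff : `|F b - F a| <= h b - h a + e * (b - a).
  move=> /le_trans; apply; rewrite lerD2l /e mulrAC ler_pdivrMr//.
  by rewrite ler_pM2l// lerDl.
apply: (@segment_chain a b
  (fun x y => `|F y - F x| <= h y - h x + e * (y - x))) => //.
  move=> x y z _ _ xy yz; rewrite -(subrK (F y) (F z)) -addrA.
  by rewrite (le_trans (ler_normD _ _))// (le_trans (lerD yz xy))//; lra.
move=> c cab; have [dF dh Fhc] := Fh c cab.
have e20 : 0 < e / 2 by rewrite divr_gt0.
have [d1 d10 F1] := derivable_expansion _ _ _ dF e20.
have [d2 d20 h2] := derivable_expansion _ _ _ dh e20.
exists (Num.min d1 d2); first by rewrite lt_min d10.
move=> x y /andP[_ xc] /andP[cy _]; rewrite lt_min => /andP[xy1 xy2].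
have xE : `|x - c| = c - x by rewrite ler0_norm ?opprB// subr_le0.
have yE : `|y - c| = y - c by rewrite ger0_norm// subr_ge0.
have [x1 x2] : `|x - c| < d1 /\ `|x - c| < d2 by rewrite xE; split; lra.
have [y1 y2] : `|y - c| < d1 /\ `|y - c| < d2 by rewrite yE; split; lra.
have {x1} := F1 _ x1; have {y1} := F1 _ y1.
have {x2} := h2 _ x2; have {y2} := h2 _ y2.
rewrite xE yE !ler_norml => /andP[hy _] /andP[_ hx] Fy Fx.
set D := 'D_1 F c in Fhc Fy Fx; set D' : R := 'D_1 h c in Fhc hy hx.
have {}hy : (y - c) * D' - e / 2 * (y - c) <= h y - h c.
  by move: hy; rewrite /GRing.scale/=; lra.
have {}hx : (c - x) * D' - e / 2 * (c - x) <= h c - h x.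
  by move: hx; rewrite /GRing.scale/=; lra.
have -> : F y - F x = (F y - F c - (y - c) *: D) - (F x - F c - (x - c) *: D)
    + (y - x) *: D.
  have -> : (y - x) *: D = (y - c) *: D - (x - c) *: D.
    by rewrite -scalerBl; congr (_ *: _); ring.
  have zE (p q u v : V) : p - q = p - u - (q - v) + (u - v).
    by rewrite opprB (addrC v) addrACA subrK addrK.
  by rewrite -zE opprB addrA subrK.
rewrite (le_trans (ler_normD _ _))//.
rewrite (le_trans (lerD (ler_normB _ _) (lexx _)))//.
have xy : 0 <= y - x by rewrite subr_ge0 (le_trans xc).
have : `|(y - x) *: D| <= (y - x) * D'.
  by rewrite normrZ ger0_norm// ler_wpM2l.
lra.
Qed.

(** Differentiability at the ends is dropped by a passage to the limit; this
    is needed for powers with a real exponent, at 0. *)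
Lemma mean_value {V : normedModType R} (F : R -> V) (h : R -> R) (a b : R) :
  a <= b ->
  {within `[a, b], continuous F} -> {within `[a, b], continuous h} ->
  (forall t, a < t < b ->
     [/\ derivable F t 1, derivable h t 1 & `|'D_1 F t| <= 'D_1 h t]) ->
  `|F b - F a| <= h b - h a.
Proof.
rewrite le_eqVlt => /predU1P[->|ab]; first by rewrite !subrr normr0.
move=> /(continuous_within_itvP _ ab)[_ Fa Fb].
move=> /(continuous_within_itvP _ ab)[_ ha hb] Fh.
pose m := (a + b) / 2.
have [am mb] : a < m /\ m < b by rewrite /m; split; lra.
have inner x y : a < x -> x <= y -> y < b -> `|F y - F x| <= h y - h x.
  move=> ax xy yb; apply: mean_value_closed => // t /andP[xt ty].
  by apply: Fh; rewrite (lt_le_trans ax)//= (le_lt_trans ty).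
have right_half : `|F b - F m| <= h b - h m.
  apply: (@ler_cvg_to _ (b^'-) _ R (fun y => `|F y - F m|) (fun y => h y - h m)).
  - by apply: cvg_norm; apply: cvgB => //; exact: cvg_cst.
  - by apply: cvgB => //; exact: cvg_cst.
  - near=> y; apply: inner => //.
    by near: y; exact: nbhs_left_ge.
have left_half : `|F m - F a| <= h m - h a.
  apply: (@ler_cvg_to _ (a^'+) _ R (fun y => `|F m - F y|) (fun y => h m - h y)).
  - by apply: cvg_norm; apply: cvgB => //; exact: cvg_cst.
  - by apply: cvgB => //; exact: cvg_cst.
  - near=> y; apply: inner => //.
    by near: y; exact: nbhs_right_le.
rewrite -(subrK (F m) (F b)) -addrA (le_trans (ler_normD _ _))//.
by rewrite (le_trans (lerD right_half left_half))//; lra.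
Unshelve. all: by end_near. Qed.

End MeanValue.

(** * Riemann integral of a continuous vector valued function *)

Section Riemann.
Context {R : realType}.

(** The existence of a modulus for [e] on a segment is itself transitive in the
    ends of the segment, thanks to continuity at the junction. *)
Lemma segment_uniform_continuity {V : normedModType R} (g : R -> V) (a b e : R) :
  a <= b -> (forall t, a <= t <= b -> {for t, continuous g}) -> 0 < e ->
  exists2 d : R, 0 < d & forall x y, a <= x <= b -> a <= y <= b ->
    `|x - y| < d -> `|g x - g y| <= e.
Proof.
move=> ab gc e0; have e20 : 0 < e / 2 by rewrite divr_gt0.
have loc c : a <= c <= b -> exists2 d : R, 0 < d &
    forall u v, `|u - c| < d -> `|v - c| < d -> `|g u - g v| <= e.
  move=> cab; have /cvgrPdist_le/(_ _ e20)[d d0 dP] := gc c cab.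
  exists d => // u v uc vc; rewrite (le_trans (ler_distD (g c) _ _))//.
  by rewrite [e]splitr lerD// 1?[`|g u - _|]distrC dP//= distrC.
apply: (@segment_chain R a b (fun x y => exists2 d : R, 0 < d &
    forall u v, x <= u <= y -> x <= v <= y -> `|u - v| < d ->
      `|g u - g v| <= e)) => //.
  move=> x y z /andP[ax xy] /andP[yz zb] [d1 d10 h1] [d2 d20 h2].
  have [|d3 d30 h3] := loc y; first by rewrite (le_trans ax)//= (le_trans yz).
  exists (Num.min d1 (Num.min d2 d3)); first by rewrite !lt_min d10 d20.
  have half u v : x <= u <= z -> x <= v <= z -> u <= v ->
      `|u - v| < Num.min d1 (Num.min d2 d3) -> `|g u - g v| <= e.
    move=> /andP[xu uz] /andP[xv vz] uv; rewrite !lt_min => /and3P[u1 u2 u3].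
    have [vy|yv] := leP v y; first by apply: h1; rewrite ?xu ?xv//= (le_trans uv).
    have [yu|uy] := leP y u; first by apply: h2; rewrite ?yu ?(ltW yv).
    rewrite ler0_norm ?subr_le0// in u3.
    by apply: h3; [rewrite ltr0_norm|rewrite gtr0_norm]; lra.
  move=> u v uxz vxz; have [uv|/ltW vu] := leP u v; first exact: half.
  by rewrite distrC [`|g _ - _|]distrC; exact: half.
move=> c cab; have [d d0 dP] := loc c cab; exists d => // x y.
move=> /andP[_ xc] /andP[cy _] xyd; exists 1 => // u v /andP[xu uy] /andP[xv vy] _.
by apply: dP; rewrite ltr_norml; apply/andP; split; lra.
Qed.

(** [Q] is a primitive of [g] on the unit segment, ends included, uniformly:
    this form of the statement applies to Riemann sums term by term. *)
Definition uniform_primitive {V : normedModType R} (g Q : R -> V) : Prop :=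
  forall e : R, 0 < e -> exists2 d : R, 0 < d &
    forall x xi y : R, 0 <= x -> x <= xi -> xi <= y -> y <= 1 -> y - x < d ->
      `|Q y - Q x - (y - x) *: g xi| <= e * (y - x).

Definition grid_node (n i : nat) : R := i%:R / n%:R.

(** The length of the part of the [i]-th cell of the grid that lies to the left
    of [t]. *)
Definition grid_clip (n i : nat) (t : R) : R :=
  Num.min t (grid_node n i.+1) - Num.min t (grid_node n i).

Lemma grid_clip_homo n i : {homo grid_clip n i : x y / x <= y}.
Proof.
move=> x y xy; rewrite /grid_clip.
have : grid_node n i <= grid_node n i.+1 by rewrite ler_wpM2r ?invr_ge0// ler_nat.
set u := grid_node n i; set v := grid_node n i.+1 => uv.
by rewrite /Num.min; do 4 case: ifPn; rewrite -?leNgt; lra.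
Qed.

Lemma sum_grid_clip n x : (0 < n)%N -> 0 <= x <= 1 ->
  \sum_(0 <= i < n) grid_clip n i x = x.
Proof.
move=> n0 /andP[x0 x1]; rewrite telescope_sumr//.
rewrite /grid_node divff ?pnatr_eq0 -?lt0n// mul0r.
by rewrite (min_idPl x1) (min_idPr x0) subr0.
Qed.

Section StepPrimitive.
Context {V : completeNormedModType R} (g : R -> V).

(** The primitive, vanishing at 0, of the step function that takes on each cell
    of the grid the value of [g] at the left end. *)
Definition step_primitive (n : nat) (t : R) : V :=
  \sum_(0 <= i < n) grid_clip n i t *: g (grid_node n i).

(** The increment from [x] to [y] is a combination of the [g (grid_node n i)]
    with nonnegative weights that add up to [y - x]; the cells that do not
    meet the segment have weight 0. *)
Lemma step_primitive_increment (n : nat) (d e : R) : (0 < n)%N ->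
  (forall x y, 0 <= x <= 1 -> 0 <= y <= 1 -> `|x - y| < d -> `|g x - g y| <= e) ->
  forall x xi y : R, 0 <= x -> x <= xi -> xi <= y -> y <= 1 -> y - x + n%:R^-1 < d ->
  `|step_primitive n y - step_primitive n x - (y - x) *: g xi| <= e * (y - x).
Proof.
move=> n0 ge x xi y x0 xxi xiy y1 yxd.
have xy : x <= y by exact: le_trans xiy.
have yxE : y - x = \sum_(0 <= i < n) (grid_clip n i y - grid_clip n i x).
  rewrite sumrB !sum_grid_clip//; first by rewrite x0 (le_trans xy).
  by rewrite (le_trans x0).
have -> : step_primitive n y - step_primitive n x - (y - x) *: g xi =
    \sum_(0 <= i < n)
       (grid_clip n i y - grid_clip n i x) *: (g (grid_node n i) - g xi).
  rewrite [X in _ - X *: _]yxE scaler_suml /step_primitive -!sumrB.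
  by apply: eq_bigr => i _; rewrite -scalerBl -scalerBr.
rewrite [X in _ * X]yxE mulr_sumr (le_trans (ler_norm_sum _ _ _))//.
rewrite big_nat [leRHS]big_nat; apply: ler_sum => i /andP[_ iN].
have c0 : 0 <= grid_clip n i y - grid_clip n i x by rewrite subr_ge0 grid_clip_homo.
rewrite normrZ ger0_norm// mulrC.
have [-> |cN0] := eqVneq (grid_clip n i y - grid_clip n i x) 0.
  by rewrite !mulr0.
rewrite ler_wpM2r//.
have node0 : 0 <= grid_node n i by rewrite divr_ge0.
have node1 : grid_node n i <= 1 by rewrite ler_pdivrMr ?ltr0n// mul1r ler_nat ltnW.
have nodeS : grid_node n i.+1 = grid_node n i + n%:R^-1.
  by rewrite /grid_node -natr1 mulrDl mul1r.
have inv0 : 0 < (n%:R : R)^-1 by rewrite invr_gt0 ltr0n.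
have [h1 h2] : grid_node n i <= y /\ x <= grid_node n i.+1.
  move: cN0; rewrite /grid_clip nodeS; split; rewrite leNgt; apply/negP => h.
    move/negP: cN0; apply; rewrite !min_l ?subrr//; apply: ltW; lra.
  by move/negP: cN0; apply; rewrite !min_r ?subrr//; apply: ltW; lra.
rewrite nodeS in h2.
apply: ge; rewrite ?node0 ?node1//; first by rewrite (le_trans x0)//= (le_trans xiy).
by rewrite ltr_norml; apply/andP; split; lra.
Qed.

Lemma step_primitive0 n : step_primitive n 0 = 0.
Proof.
have min0 j : Num.min 0 (grid_node n j) = 0 by rewrite min_l// divr_ge0.
by rewrite /step_primitive big1// => i _; rewrite /grid_clip !min0 subrr scale0r.
Qed.

(** On short segments two step primitives of fine grids both move by almost
    [(y - x) *: g x], so by [increment_le] they form a Cauchy sequence. *)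
Lemma continuous_primitive :
  (forall t : R, 0 <= t <= 1 -> {for t, continuous g}) ->
  exists Q : R -> V, uniform_primitive g Q.
Proof.
move=> gc.
have inv_lt (d : R) : 0 < d -> exists N, forall n, (N <= n)%N ->
    (0 < n)%N /\ (n%:R : R)^-1 < d.
  move=> d0; exists (Num.truncn d^-1).+1 => n Nn.
  have n0 : (0 < n)%N by exact: leq_ltn_trans Nn.
  split=> //; rewrite invf_plt ?posrE ?ltr0n//.
  by rewrite (lt_le_trans (truncnS_gt _))// ler_nat.
have stepP e : 0 < e -> exists2 d : R, 0 < d & exists N, forall n, (N <= n)%N ->
    forall x xi y : R, 0 <= x -> x <= xi -> xi <= y -> y <= 1 -> y - x < d ->
    `|step_primitive n y - step_primitive n x - (y - x) *: g xi| <= e * (y - x).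
  move=> e0; have [d d0 dP] := segment_uniform_continuity _ _ _ _ ler01 gc e0.
  have d20 : 0 < d / 2 by rewrite divr_gt0.
  have [N NP] := inv_lt _ d20; exists (d / 2) => //.
  exists N => n /NP[n0 nd] x xi y x0 xxi xiy y1 yxd.
  by apply: (step_primitive_increment _ d) => //; lra.
have cvP t : 0 <= t <= 1 -> cvg (step_primitive n t @[n --> \oo]).
  move=> /andP[t0 t1]; apply: cauchy_cvg; apply: cauchy_exP => e e0.
  have e40 : 0 < e / 4 by rewrite divr_gt0.
  have [d d0 [N NP]] := stepP _ e40.
  exists (step_primitive N t); rewrite /= nbhs_simpl/=; exists N => // n /= Nn.
  rewrite -ball_normE/=.
  pose D t := step_primitive N t - step_primitive n t.
  have : `|D t - D 0| <= e / 2 * (t - 0).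
    apply: (@increment_le R V D _ 0 1 d) => //.
    move=> x y x0 xy y1 xyd.
    have h1 := NP N (leqnn N) x x y x0 (lexx _) xy y1 xyd.
    have h2 := NP n Nn x x y x0 (lexx _) xy y1 xyd.
    have zE (p q u v w : V) : p - q - (u - v) = p - u - w - (q - v - w).
      rewrite [in RHS]opprB [in RHS]addrA subrK !opprB.
      by rewrite addrACA [RHS]addrACA [- q - u]addrC.
    rewrite /D (zE _ _ _ _ ((y - x) *: g x)).
    rewrite (le_trans (ler_normB _ _))//; lra.
  rewrite /D !step_primitive0 !subr0 => /le_lt_trans; apply.
  have : e / 2 * t <= e / 2 by rewrite ler_piMr// divr_ge0// ltW.
  lra.
exists (fun t => lim (step_primitive n t @[n --> \oo])) => e e0.
have [d d0 [N NP]] := stepP _ e0; exists d => // x xi y x0 xxi xiy y1 xyd.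
have xy := le_trans xxi xiy.
have cx : step_primitive n x @[n --> \oo] --> lim (step_primitive n x @[n --> \oo]).
  by apply: cvP; rewrite x0 (le_trans xy).
have cy : step_primitive n y @[n --> \oo] --> lim (step_primitive n y @[n --> \oo]).
  by apply: cvP; rewrite y1 (le_trans x0).
apply: (@ler_cvg_to _ \oo _ R
  (fun n => `|step_primitive n y - step_primitive n x - (y - x) *: g xi|)
  (fun=> e * (y - x))).
- by apply: cvg_norm; apply: cvgB; [exact: cvgB|exact: cvg_cst].
- exact: cvg_cst.
- by exists N => // n /= Nn; exact: NP.
Qed.

End StepPrimitive.

Section RiemannIntegral.
Context {V : normedModType R} (g Q : R -> V).
Context (Qg : uniform_primitive g Q).

Lemma primitive_is_riemann_integral : is_riemann_integral g 0 1 (Q 1 - Q 0).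
Proof.
move=> e e0; have e20 : 0 < e / 2 by rewrite divr_gt0.
have [d d0 dP] := Qg _ e20; exists d => // s xi s01 sd.
have tel (W : zmodType) (F : R -> W) :
    \sum_(0 <= i < size s) (F s`_i - F (0 :: s)`_i) = F 1 - F 0.
  rewrite (telescope_sumr (fun i => F (0 :: s)`_i))//.
  by rewrite (itv_partition_nth_size _ s01).
rewrite -(tel _ Q) /riemann_sum -sumrB.
apply: (@le_lt_trans _ _ (e / 2)); last lra.
rewrite -[leRHS]mulr1 -[X in _ * X]subr0 -(tel R id) mulr_sumr.
rewrite (le_trans (ler_norm_sum _ _ _))//.
rewrite big_nat [leRHS]big_nat; apply: ler_sum => i /andP[_ iN].
have [/andP[l1 l2] l3] := sd i iN.
rewrite distrC dP//.
  have := @itv_partition_nth_ge _ _ 0 1 s i (leqW iN) s01.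
  by rewrite (set_nth_default 0)//= ltnW.
have := @itv_partition_nth_le _ _ 0 1 s i.+1 iN s01.
by rewrite (set_nth_default 0).
Qed.

(** The regular subdivisions have arbitrarily small mesh. *)
Lemma riemann_integral_unique (J K : V) :
  is_riemann_integral g 0 1 J -> is_riemann_integral g 0 1 K -> J = K.
Proof.
move=> gJ gK; apply/eqP; rewrite -subr_eq0 -normr_le0.
apply/ler_addgt0Pr => e e0; rewrite add0r.
have e20 : 0 < e / 2 by rewrite divr_gt0.
have [d1 d10 J1] := gJ _ e20; have [d2 d20 K2] := gK _ e20.
have [s [s01 sd]] : exists s : seq R, itv_partition 0 1 s /\
    forall i, (i < size s)%N -> (0 :: s)`_i <= s`_i /\
      s`_i - (0 :: s)`_i < Num.min d1 d2.
  pose n := Num.truncn (Num.min d1 d2)^-1.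
  have n1 : (n.+1%:R : R)^-1 < Num.min d1 d2.
    by rewrite invf_plt ?posrE ?lt_min ?d10// truncnS_gt.
  have n0 : 0 < (n.+1%:R : R)^-1 by rewrite invr_gt0.
  pose s : seq R := [seq i.+1%:R / n.+1%:R | i <- iota 0 n.+1].
  have sn : size s = n.+1 by rewrite size_map size_iota.
  have sE i : (i < n.+1)%N -> s`_i = i.+1%:R / n.+1%:R.
    by move=> iN; rewrite (nth_map 0%N) ?size_iota// nth_iota.
  have sE' i : (i < n.+1)%N -> (0 :: s)`_i = i%:R / n.+1%:R.
    by case: i => [|i] iN /=; [rewrite mul0r|rewrite sE// ltnW].
  have stp i : (i < n.+1)%N -> s`_i - (0 :: s)`_i = n.+1%:R^-1.
    by move=> iN; rewrite sE// sE'// -natr1 mulrDl mul1r addrAC subrr add0r.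
  exists s; split.
    split; last by rewrite (last_nth 0) sn/= sE// divff.
    apply/(pathP 0) => i; rewrite sn => iN.
    by rewrite -subr_gt0 stp.
  move=> i; rewrite sn => iN; split; last by rewrite stp.
  by rewrite -subr_ge0 stp// ltW.
have J3 := J1 s (fun i => (0 :: s)`_i) s01; have K3 := K2 s (fun i => (0 :: s)`_i) s01.
rewrite (le_trans (ler_distD (riemann_sum g 0 s (fun i => (0 :: s)`_i)) _ _))//.
rewrite [e]splitr lerD//.
  rewrite distrC ltW// J3// => i /sd[s1]; rewrite lt_min => /andP[s2 _].
  by rewrite lexx s1.
by rewrite ltW// K3// => i /sd[s1]; rewrite lt_min => /andP[_ s2]; rewrite lexx s1.
Qed.

Lemma riemann_integralE : riemann_integral g 0 1 = Q 1 - Q 0.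
Proof.
apply: riemann_integral_unique; last exact: primitive_is_riemann_integral.
by apply: getPex; exists (Q 1 - Q 0); exact: primitive_is_riemann_integral.
Qed.

Lemma primitive_derivative (t : R) : 0 < t < 1 -> is_derive t 1 Q (g t).
Proof.
move=> /andP[t0 t1].
suff cv : (fun h => h^-1 *: ((Q \o shift t) (h *: 1) - Q t)) @ 0^' --> g t.
  by apply: DeriveDef; [exact: (cvgP _ cv)|exact: (cvg_lim (@norm_hausdorff _ _) cv)].
apply/cvgrPdist_le => e e0; have [d d0 dP] := Qg _ e0.
exists (Num.min d (Num.min t (1 - t))); first by rewrite /= !lt_min d0 t0 subr_gt0.
move=> h /=; rewrite sub0r normrN !lt_min => /and3P[hd ht h1] hN0.
rewrite scaler1.
have -> : g t - h^-1 *: (Q (h + t) - Q t) = - (h^-1 *: (Q (h + t) - Q t - h *: g t)).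
  by rewrite [in RHS]scalerBr scalerA mulVf// scale1r opprB.
rewrite normrN normrZ normfV ler_pdivrMl ?normr_gt0// mulrC.
have [hp|hn] := ltP 0 h.
  rewrite gtr0_norm// in hd ht h1 *.
  have := dP t t (h + t); rewrite addrK; apply; rewrite ?lexx//; lra.
rewrite ler0_norm// in hd ht h1 *.
have tE : t - (h + t) = - h by ring.
have := dP (h + t) t t; rewrite tE scaleNr -(normrN (Q t - _ - _)) !opprB.
rewrite [- _ + (_ - _)]addrC.
apply; rewrite ?lexx//; lra.
Qed.

Lemma primitive_continuous : {within `[0, 1], continuous Q}.
Proof.
have Qbound xi e : 0 < e -> exists2 d : R, 0 < d & forall x y,
    0 <= x -> x <= xi -> xi <= y -> y <= 1 -> y - x < d -> `|Q y - Q x| <= e.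
  move=> e0; have [d d0 dP] := Qg 1 ltr01; have g0 := normr_ge0 (g xi).
  have g1 : 0 < 1 + `|g xi| by lra.
  exists (Num.min d (e / (1 + `|g xi|))); first by rewrite lt_min d0 divr_gt0.
  move=> x y x0 xxi xiy y1; rewrite lt_min ltr_pdivlMr// => /andP[yxd yxe].
  rewrite -[Q y - Q x](subrK ((y - x) *: g xi)) (le_trans (ler_normD _ _))//.
  rewrite (le_trans (lerD (dP x xi y x0 xxi xiy y1 yxd) (lexx _)))//.
  by rewrite normrZ ger0_norm; lra.
apply/(continuous_within_itvP _ ltr01); split.
- move=> t; rewrite in_itv/= => t01; apply/differentiable_continuous/derivable1_diffP.
  by have [] := primitive_derivative t t01.
- apply/cvgrPdist_le => e e0; have [d d0 dP] := Qbound 0 _ e0.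
  exists (Num.min d 1); first by rewrite /= lt_min d0 ltr01.
  move=> t /=; rewrite sub0r normrN lt_min => /andP[td t1] t0.
  rewrite gtr0_norm// in td t1; by rewrite distrC dP ?subr0 ?(ltW t0) ?(ltW t1).
- apply/cvgrPdist_le => e e0; have [d d0 dP] := Qbound 1 _ e0.
  exists (Num.min d 1); first by rewrite /= lt_min d0 ltr01.
  move=> t /=; rewrite lt_min => /andP[td t0] t1.
  rewrite gtr0_norm ?subr_gt0// in td t0; by rewrite dP ?(ltW t1) ?(ltW td)//; lra.
Qed.

End RiemannIntegral.
End Riemann.

(** * The weighted trapezoid inequality *)

Section WeightedTrapezoid.
Context {R : realType}.

Lemma is_derive_affine_scale {V : normedModType R} (g : R -> V) (c t : R) :
  derivable g t 1 ->
  is_derive t 1 (fun x : R => (x - c) *: g x) (g t + (t - c) *: 'D_1 g t).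
Proof.
move=> dg.
have cg : {for t, continuous g}.
  exact/differentiable_continuous/derivable1_diffP.
suff cv : (fun h => h^-1 *: (((fun x : R => (x - c) *: g x) \o shift t) (h *: 1)
    - (t - c) *: g t)) @ 0^' --> g t + (t - c) *: 'D_1 g t.
  by apply: DeriveDef; [exact: (cvgP _ cv)|exact: (cvg_lim (@norm_hausdorff _ _) cv)].
have cgs : g (h + t) @[h --> 0^'] --> g t.
  have st : h + t @[h --> (0 : R)] --> t.
    by rewrite -[X in _ --> X]add0r; apply: cvgD; [exact: cvg_id|exact: cvg_cst].
  have sg := cvg_comp (fun h => h + t) g st cg.
  by apply: (@cvg_within_filter _ _ _ (nbhs (0 : R))); exact: sg.
have dgD : h^-1 *: ((g \o shift t) (h *: 1) - g t) @[h --> 0^'] --> 'D_1 g t.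
  exact: dg.
have cv := cvgD cgs (cvgZl_tmp dgD (k := t - c)).
apply: cvg_trans; last exact: cv.
apply: near_eq_cvg; near=> h.
have h0 : h != 0 by near: h; exact: nbhs_dnbhs_neq.
rewrite /= !fctE/= scaler1; have -> : h + t - c = h + (t - c) by ring.
have zE (k l : R) (u w : V) : (k + l) *: u - l *: w = k *: u + l *: (u - w).
  by rewrite scalerDl scalerBr addrA.
rewrite zE [h^-1 *: (h *: _ + _)]scalerDr !scalerA mulVf// scale1r.
by rewrite (mulrC h^-1).
Unshelve. all: by end_near. Qed.

(** For a primitive [Q] of [g], the vector to be bounded is the increment over
    the unit segment of [G t = (t - nu) *: g t - Q t], whose derivative is
    [(t - nu) *: 'D_1 g t]. The mean value inequality compares [G] with [K] to
    the right of [nu] and with [- K] to the left, where [t - nu] is negative. *)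
Lemma weighted_trapezoid_le {V : completeNormedModType R} (g : R -> V)
    (psi K : R -> R) (nu : R) :
  0 <= nu <= 1 -> (forall t : R, 0 <= t <= 1 -> derivable g t 1) ->
  {within `[0, 1], continuous K} ->
  (forall t : R, 0 < t < 1 ->
     `|'D_1 g t| <= psi t /\ is_derive t 1 K ((t - nu) * psi t)) ->
  `|nu *: g 0 + (1 - nu) *: g 1 - riemann_integral g 0 1| <= K 0 + K 1 - 2 * K nu.
Proof.
move=> /andP[nu0 nu1] dg cK gK.
have cg (t : R) : 0 <= t <= 1 -> {for t, continuous g}.
  by move=> t01; apply/differentiable_continuous/derivable1_diffP/dg.
have [Q Qg] := continuous_primitive g cg.
rewrite (riemann_integralE _ _ Qg).
pose G (t : R) : V := (t - nu) *: g t - Q t.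
have dG (t : R) : 0 < t < 1 -> is_derive t 1 G ((t - nu) *: 'D_1 g t).
  move=> t01; have dQ := primitive_derivative _ _ Qg t t01.
  have /andP[/ltW t0 /ltW t1] := t01.
  have dgt := @is_derive_affine_scale V g nu t (dg t (introT andP (conj t0 t1))).
  by apply: is_derive_eq; rewrite addrAC subrr add0r.
have cG : {within `[0, 1], continuous G}.
  apply: within_continuousB; last exact: primitive_continuous Qg.
  apply: continuous_in_subspaceT => t /set_mem/=; rewrite in_itv/= => t01.
  apply/differentiable_continuous/derivable1_diffP.
  by have [] := @is_derive_affine_scale V g nu t (dg t t01).
have sub (W : normedModType R) (h : R -> W) a b : 0 <= a -> b <= 1 ->
    {within `[0, 1], continuous h} -> {within `[a, b], continuous h}.
  move=> a0 b1; apply: continuous_subspaceW => t /=.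
  by rewrite !in_itv/= => /andP[at' tb]; rewrite (le_trans a0)// (le_trans tb).
have right_part : `|G 1 - G nu| <= K 1 - K nu.
  apply: mean_value => //; [exact: sub|exact: sub|move=> t /andP[nut t1]].
  have t01 : 0 < t < 1 by rewrite t1 (le_lt_trans nu0).
  have [gpsi dK] := gK t t01; have dGt := dG t t01.
  split; [exact: ex_derive|exact: ex_derive|rewrite !derive_val].
  by rewrite normrZ gtr0_norm ?subr_gt0// ler_wpM2l// subr_ge0 ltW.
have left_part : `|G nu - G 0| <= K 0 - K nu.
  have -> : K 0 - K nu = (- K) nu - (- K) 0 by rewrite /= opprK addrC.
  apply: mean_value => //; [exact: sub| |move=> t /andP[t0 tnu]].
    by apply: sub => // x; apply: cvgN; exact: cK.
  have t01 : 0 < t < 1 by rewrite t0 (lt_le_trans tnu).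
  have [gpsi dK] := gK t t01; have dGt := dG t t01.
  split; [exact: ex_derive|exact: ex_derive|rewrite !derive_val].
  by rewrite normrZ ltr0_norm ?subr_lt0// -mulNr ler_wpM2l// oppr_ge0 subr_le0 ltW.
have -> : nu *: g 0 + (1 - nu) *: g 1 - (Q 1 - Q 0) = (G 1 - G nu) + (G nu - G 0).
  rewrite addrA subrK /G sub0r scaleNr !opprD !opprK.
  by rewrite [_ *: g 0 + _ *: g 1]addrC addrACA.
rewrite (le_trans (ler_normD _ _))// (le_trans (lerD right_part left_part))//.
lra.
Qed.

Lemma powR_within_continuous (p : R) : 0 < p ->
  {within `[0, 1], continuous (fun t : R => t `^ p)}.
Proof.
move=> p0; apply/(continuous_within_itvP _ ltr01); split.
- move=> t; rewrite in_itv/= => /andP[t0 _].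
  by apply/differentiable_continuous/derivable1_diffP; have [] := is_derive1_powR p t0.
- by rewrite powR0 ?gt_eqF//; exact: powR_cvg0.
- have c1 : {for (1 : R), continuous (fun t : R => t `^ p)}.
    apply/differentiable_continuous/derivable1_diffP.
    by have [] := is_derive1_powR p (@ltr01 R).
  by apply: cvg_at_left_filter; exact: c1.
Qed.

Lemma onem_within_continuous (h : R -> R) : {within `[0, 1], continuous h} ->
  {within `[0, 1], continuous (fun t => h (1 - t))}.
Proof.
move=> /(continuous_within_itvP _ ltr01)[hc h0 h1].
apply/(continuous_within_itvP _ ltr01); split.
- move=> t; rewrite in_itv/= => /andP[t0 t1].
  have c1 : 1 - u @[u --> t] --> 1 - t.
    by apply: cvgB; [exact: cvg_cst|exact: cvg_id].
  have ht : {for 1 - t, continuous h}.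
    by apply: hc; rewrite in_itv/=; apply/andP; split; lra.
  exact: (cvg_comp (fun u => 1 - u) h c1 ht).
- rewrite subr0; apply/cvgrPdist_le => e e0.
  move/cvgrPdist_le : h1 => /(_ e e0)[d d0 dP]; exists d => // t /= td t0.
  by apply: dP; [rewrite /= opprB addrCA subrr addr0 -normrN -sub0r|lra].
- rewrite subrr; apply/cvgrPdist_le => e e0.
  move/cvgrPdist_le : h0 => /(_ e e0)[d d0 dP]; exists d => // t /= td t0.
  by apply: dP; [rewrite /= sub0r normrN|lra].
Qed.

(** The primitive of [(t - a) * t `^ s] that vanishes at 0. *)
Definition moment (a s t : R) : R :=
  t `^ (s + 2) / (s + 2) - a * (t `^ (s + 1) / (s + 1)).

Lemma is_derive_moment (a s t : R) : 0 < s -> 0 < t ->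
  is_derive t 1 (moment a s) ((t - a) * t `^ s).
Proof.
move=> s0 t0.
have s1 : s + 1 != 0 by rewrite gt_eqF//; lra.
have s2 : s + 2 != 0 by rewrite gt_eqF//; lra.
have d2 := is_derive1_powR (s + 2) t0; have d1 := is_derive1_powR (s + 1) t0.
rewrite (_ : s + 1 - 1 = s) in d1; last by ring.
rewrite (_ : s + 2 - 1 = s + 1) in d2; last by ring.
have ts : t `^ (s + 1) = t * t `^ s.
  by rewrite -[in RHS](addrK 1 s) mulr_powRB1 ?ltW//; lra.
have -> : moment a s = ((s + 2)^-1 *: (fun x : R => x `^ (s + 2)))
    - ((a / (s + 1)) *: (fun x : R => x `^ (s + 1))).
  apply/funext => x; rewrite /moment /= !fctE /GRing.scale/=; field.
  by rewrite s1 s2.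
apply: is_derive_eq.
rewrite ts /GRing.scale/=; field.
by rewrite s1 s2.
Qed.

Lemma moment_within_continuous (a s : R) : 0 < s ->
  {within `[0, 1], continuous (moment a s)}.
Proof.
move=> s0.
have c2 : {within `[0, 1], continuous (fun t : R => t `^ (s + 2))}.
  by apply: powR_within_continuous; lra.
have c1 : {within `[0, 1], continuous (fun t : R => t `^ (s + 1))}.
  by apply: powR_within_continuous; lra.
move=> t; apply: cvgB; first by apply: cvgM; [exact: c2|exact: cvg_cst].
apply: cvgM; first exact: cvg_cst.
by apply: cvgM; [exact: c1|exact: cvg_cst].
Qed.

(** If [a <= 1], this is the integral over the unit segment of
    [`|t - a| * t `^ s]. *)
Lemma moment_span (a s : R) : 0 < s -> 0 <= a ->
  moment a s 0 + moment a s 1 - 2 * moment a s a =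
  (s + 2)^-1 - a / (s + 1) + 2 * a `^ (s + 2) / ((s + 1) * (s + 2)).
Proof.
move=> s0 a0.
have s1 : s + 1 != 0 by rewrite gt_eqF//; lra.
have s2 : s + 2 != 0 by rewrite gt_eqF//; lra.
rewrite /moment !powR1 !powR0//.
have -> : a `^ (s + 2) = a * a `^ (s + 1).
  by rewrite -[s + 1](_ : s + 2 - 1 = _) ?mulr_powRB1//; lra.
by field; rewrite s1 s2.
Qed.

Lemma is_derive_sqr_half (c nu t : R) :
  is_derive t 1 (fun x : R => c / 2 * (x - nu) ^+ 2) ((t - nu) * c).
Proof.
have -> : (fun x : R => c / 2 * (x - nu) ^+ 2) = (c / 2) *: ((id - cst nu) ^+ 2).
  by apply/funext => x; rewrite !fctE.
apply: is_derive_eq; rewrite !fctE /GRing.scale/= subr0 expr1.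
by field.
Qed.

(** The weight of [b] is [t `^ s], that of [a] is [(1 - t) `^ s]; the reflection
    of [t] into [1 - t] turns [nu] into [1 - nu]. *)
Lemma is_derive_two_moments (a b nu s t : R) : 0 < s -> 0 < t < 1 ->
  is_derive t 1 (fun x : R => b * moment nu s x + a * moment (1 - nu) s (1 - x))
    ((t - nu) * ((1 - t) `^ s * a + t `^ s * b)).
Proof.
move=> s0 /andP[t0 t1].
have d1 := is_derive_moment nu s t s0 t0.
have t1' : 0 < 1 - t by rewrite subr_gt0.
have d2 := is_derive_moment (1 - nu) s (1 - t) s0 t1'.
have d3 : is_derive t 1 (fun x : R => 1 - x) (- 1).
  have -> : (fun x : R => 1 - x) = cst 1 - id by [].
  by apply: is_derive_eq; rewrite sub0r.
have d4 := @is_derive1_comp R (moment (1 - nu) s) (fun x : R => 1 - x) t _ _ d2 d3.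
have -> : (fun x : R => b * moment nu s x + a * moment (1 - nu) s (1 - x)) =
    b *: moment nu s + a *: (moment (1 - nu) s \o (fun x : R => 1 - x)).
  by apply/funext => x.
have dZ1 := is_deriveZ b d1; have dZ4 := is_deriveZ a d4.
have dD := is_deriveD dZ1 dZ4.
move: dD; rewrite [X in is_derive _ _ _ X](_ : _ =
  (t - nu) * ((1 - t) `^ s * a + t `^ s * b))//.
rewrite /GRing.scale/=.
by move: (t `^ s) ((1 - t) `^ s) => u v; ring.
Qed.

End WeightedTrapezoid.

(** * Operators on a segment *)

Section OperatorSegment.
Context {R : realType} {H : hilbertType R}.

(** A continuous linear map is bounded on the unit sphere, so the supremum that
    defines [superopnorm] is a genuine one. *)
Lemma le_superopnorm (L : {linear sa H -> sa H}) (B : sa H) :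
  continuous L -> `|L B| <= superopnorm L * `|B|.
Proof.
move=> cL; have [->|B0] := eqVneq B 0.
  by rewrite linear0 !normr0 mulr0.
have nB : 0 < `|B| by rewrite normr_gt0.
rewrite -ler_pdivrMr// mulrC -(gtr0_norm nB) -normfV -normrZ -linearZ.
apply: ub_le_sup; last first.
  exists (`|B|^-1 *: B) => //=.
  by rewrite normrZ normfV normr_id mulVf// gt_eqF.
have /linear_bounded_continuous/linear_boundedP/pinfty_ex_gt0[M M0 LM] := cL.
by exists M => _ [C /= C1 <-]; have := LM C; rewrite C1 mulr1.
Qed.

(** By the chain rule the derivative is the Frechet derivative of [cfc f] applied
    to [B - A], and [D1] gives the norm of that Frechet derivative. *)
Lemma segment_derivative (f : R -> R) (A B : sa H) (t : R) : D1 H f ->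
  posdef ((1 - t) *: A + t *: B) ->
  let g (u : R) := cfc f ((1 - u) *: A + u *: B) in
  derivable g t 1 /\
  `|'D_1 g t| <= `|cfc f^`() ((1 - t) *: A + t *: B)| * `|B - A|.
Proof.
move=> fD At g; pose l (u : R) : sa H := A + u *: (B - A).
have lE u : l u = (1 - u) *: A + u *: B.
  by rewrite /l scalerBl scale1r scalerBr addrA [RHS]addrAC.
have gE : g = cfc f \o l by apply/funext => u; rewrite /g /= lE.
have dl : is_diff t l ( *:%R^~ (B - A)).
  have d0 := @is_diff_cst R R (sa H) A t.
  have d1 := @is_diff_scalel R (sa H) t (B - A).
  have d01 := @is_diffD R R (sa H) _ _ _ _ _ d0 d1.
  by rewrite add0r in d01.
rewrite -lE in At *.
have [df dfE] := fD _ At.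
have dlt : differentiable l t by exact: ex_diff.
have dg : differentiable (cfc f \o l) t by exact: differentiable_comp.
clearbody g; rewrite gE; split; first exact/derivable1_diffP.
have dlE : 'd l t (1 : R) = B - A by rewrite diff_val scale1r.
have dgE : 'd (cfc f \o l) t (1 : R) = 'd (cfc f) (l t) (B - A).
  rewrite -dlE.
  exact: (congr1 (fun h : R -> sa H => h 1) (diff_comp dlt df)).
rewrite (etrans (deriveE (1 : R) dg) dgE).
have := le_superopnorm ('d (cfc f) (l t)) (B - A) (diff_continuous df).
by rewrite dfE.
Qed.

End OperatorSegment.

Theorem mainTheorem6 (R : realType) (H : hilbertType R) (f : R -> R) (nu : R)
    (f_C2 : C2_pos f) (f_D1 : D1 H f) (nu01 : 0 <= nu <= 1) :
  let X (A B : sa H) : sa H :=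
    nu *: cfc f A + (1 - nu) *: cfc f B
    - riemann_integral (fun t : R => cfc f ((1 - t) *: A + t *: B)) 0 1 in
  (quasi_convex_on (sigma `]0, +oo[) (fun A : sa H => `|cfc f^`() A|) ->
   forall A B : sa H, posdef A -> posdef B ->
     `|X A B| <= (nu ^+ 2 - nu + 2^-1) * `|B - A|
                 * Num.max `|cfc f^`() A| `|cfc f^`() B|)
  /\
  (forall s : R, 0 < s <= 1 ->
   s_convex_on s (sigma `]0, +oo[) (fun A : sa H => `|cfc f^`() A|) ->
   forall A B : sa H, posdef A -> posdef B ->
     `|X A B| <=
       ((s + 2)^-1 - (1 - nu) / (s + 1)
        + 2 * (1 - nu) `^ (s + 2) / ((s + 1) * (s + 2)))
         * `|cfc f^`() A| * `|B - A|
       + ((s + 2)^-1 - nu / (s + 1)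
          + 2 * nu `^ (s + 2) / ((s + 1) * (s + 2)))
         * `|cfc f^`() B| * `|B - A|).
Proof.
move=> X; have /andP[nu0 nu1] := nu01.
pose g (A B : sa H) (t : R) : sa H := cfc f ((1 - t) *: A + t *: B).
have XE A B :
    X A B = nu *: g A B 0 + (1 - nu) *: g A B 1 - riemann_integral (g A B) 0 1.
  by rewrite /X /g subr0 subrr !scale0r !scale1r addr0 add0r.
have gP A B (t : R) : posdef A -> posdef B -> 0 <= t <= 1 ->
    derivable (g A B) t 1 /\
    `|'D_1 (g A B) t| <= `|cfc f^`() ((1 - t) *: A + t *: B)| * `|B - A|.
  move=> pA pB t01.
  by have := segment_derivative f A B t f_D1 (posdef_segment A B t pA pB t01).
split=> [qc A B pA pB|s /andP[s0 s1] sc A B pA pB]; rewrite XE.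
  pose M := Num.max `|cfc f^`() A| `|cfc f^`() B|.
  pose K (t : R) := M * `|B - A| / 2 * (t - nu) ^+ 2.
  rewrite -/M (_ : (nu ^+ 2 - nu + 2^-1) * `|B - A| * M = K 0 + K 1 - 2 * K nu); last first.
    by rewrite /K; field.
  apply: (weighted_trapezoid_le _ (fun=> M * `|B - A|)) => //.
  - by move=> t t01; have [] := gP A B t pA pB t01.
  - apply: continuous_subspaceT => t.
    apply/differentiable_continuous/derivable1_diffP.
    by have [] := is_derive_sqr_half (M * `|B - A|) nu t.
  move=> t /andP[/ltW t0 /ltW t1].
  have t01 : 0 <= t <= 1 by rewrite t0.
  have [_ gt] := gP A B t pA pB t01; split.
    rewrite (le_trans gt)// ler_wpM2r//; apply: qc => //; exact: posdef_sigma.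
  exact: is_derive_sqr_half.
pose a := `|cfc f^`() A| * `|B - A|; pose b := `|cfc f^`() B| * `|B - A|.
pose K (t : R) := b * moment nu s t + a * moment (1 - nu) s (1 - t).
have onem_nu : 0 <= 1 - nu by rewrite subr_ge0.
rewrite -(moment_span (1 - nu) s)// -(moment_span nu s)//.
have split_sum (p q d m0 m1 mn n0 n1 nn : R) :
    (n0 + n1 - 2 * nn) * p * d + (m0 + m1 - 2 * mn) * q * d =
    q * d * m0 + p * d * n1 + (q * d * m1 + p * d * n0)
      - 2 * (q * d * mn + p * d * nn).
  by ring.
rewrite split_sum.
suff : `|nu *: g A B 0 + (1 - nu) *: g A B 1 - riemann_integral (g A B) 0 1|
    <= K 0 + K 1 - 2 * K nu by rewrite /K (subr0 1) (subrr 1).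
apply: (weighted_trapezoid_le _ (fun t => (1 - t) `^ s * a + t `^ s * b)) => //.
- by move=> t t01; have [] := gP A B t pA pB t01.
- move=> t; apply: cvgD; apply: cvgM; [exact: cvg_cst| |exact: cvg_cst|].
    exact: moment_within_continuous.
  exact: (onem_within_continuous _ (moment_within_continuous _ _ s0)).
move=> t /andP[t0 t1].
have t01 : 0 <= t <= 1 by rewrite !ltW.
have [_ gt] := gP A B t pA pB t01; split.
  rewrite (le_trans gt)// /a /b !mulrA -mulrDl ler_wpM2r//.
  by apply: sc => //; exact: posdef_sigma.
by apply: is_derive_two_moments; rewrite ?t0.
Qed.
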